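(* Let $n\ge1$ and $Q=n+2\ge3$. Let $1<p<Q$ and $-Q(p-1)<\beta<Q-p$. Then for every $u\in C_0^\infty(\mathbb{R}^{n+1})$, $$\int_{\mathbb{R}^{n+1}}\frac{|\mathcal{L}_{\varrho,G}u(x,t)|^p}{|\nabla_G\varrho(x,t)|^p\,\varrho^\beta(x,t)}\,dx\,dt\ \ge\ \left(\frac{Q(p-1)+\beta}{p}\right)^p\int_{\mathbb{R}^{n+1}}\frac{|\nabla_{\varrho,G}u(x,t)|^p}{\varrho^{p+\beta}(x,t)}\,dx\,dt,$$ and the constant $\big(\frac{Q(p-1)+\beta}{p}\big)^p$ is best possible.
   Context: Grushin space $G=\mathbb{R}^{n+1}$: points $(x,t)$ with $x\in\mathbb{R}^n$, $t\in\mathbb{R}$; origin $o=(\vec 0,0)$; homogeneous dimension $Q=n+2$; homogeneous norm $\varrho(x,t)=(|x|^4+4t^2)^{1/4}$; Grushin gradient $\nabla_G=(\nabla_x,|x|\partial_t)$, so that $|\nabla_G\varrho|^2=|x|^2/\varrho^2=:\psi$ away from $o$. Polar coordinates $(\varrho,\phi,w)$: $x=\varrho\sin^{1/2}\!\phi\;w$, $w\in\mathbb{S}^{n-1}$, $t=\frac{\varrho^2}{2}\cos\phi$, $0<\phi<\pi$. $\partial_\varrho$ is the partial derivative in $\varrho$ in these coordinates, i.e. $\partial_\varrho u=\frac1\varrho(x\cdot\nabla_xu+2t\,\partial_tu)$. Radial operators: $\nabla_{\varrho,G}u=\psi^{1/2}(\partial_\varrho u,0,0)$, so $|\nabla_{\varrho,G}u|=\psi^{1/2}|\partial_\varrho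 u|$, and $\mathcal{L}_{\varrho,G}u=\psi\big(\partial_\varrho^2u+\frac{Q-1}{\varrho}\partial_\varrho u\big)$. $C_0^\infty$ denotes smooth compactly supported real-valued functions. ''Best possible'' means the constant cannot be replaced by a larger one. *)

(* Defs.v *)
From HB Require Import structures.
From mathcomp Require Import all_boot all_order all_algebra.
From mathcomp Require Import all_classical all_reals all_analysis.

Set Implicit Arguments.
Unset Strict Implicit.
Unset Printing Implicit Defensive.

Import Order.TTheory GRing.Theory Num.Theory.
Import numFieldNormedType.Exports.

Local Open Scope classical_set_scope.
Local Open Scope ring_scope.

(* The product Lebesgue measure on R^n, carried by [n.-tuple R] with its product
   sigma-algebra, is built by recursion on n: [prodleb_cons mu] is the image of
   [lebesgue_measure \x mu] under (s, x) |-> s :: x. *)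
Section prodleb_cons.
Context (R : realType) (n : nat).
Local Notation T := (measurableTypeR R).
Variable mu : {sigma_finite_measure set (n.-tuple T) -> \bar R}.

Definition tuple_cons (z : T * n.-tuple T) : n.+1.-tuple T :=
  [the n.+1.-tuple T of z.1 :: z.2].

Definition tuple_uncons (x : n.+1.-tuple T) : T * n.-tuple T :=
  (tnth x ord0, [tuple of behead x]).

Lemma measurable_tuple_cons : measurable_fun [set: T * n.-tuple T] tuple_cons.
Proof.
exact: (measurable_cons (T2 := T) measurable_fst measurable_snd).
Qed.

Lemma measurable_tuple_uncons :
  measurable_fun [set: n.+1.-tuple T] tuple_uncons.
Proof.
apply: measurable_fun_pair.
- exact: measurable_tnth.
- exact: measurable_behead.
Qed.

Lemma tuple_consK : cancel tuple_cons tuple_uncons.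
Proof. by case=> s x; congr (_, _); apply/val_inj. Qed.

Definition prodleb_cons : set (n.+1.-tuple T) -> \bar R :=
  pushforward (lebesgue_measure \x mu)%E tuple_cons.

Let prodleb_cons0 : prodleb_cons set0 = 0%E.
Proof. by rewrite /prodleb_cons /pushforward preimage_set0 measure0. Qed.

Let prodleb_cons_ge0 A : (0 <= prodleb_cons A)%E.
Proof. by rewrite /prodleb_cons /pushforward measure_ge0. Qed.

Let prodleb_cons_sigma_additive : semi_sigma_additive prodleb_cons.
Proof.
move=> F mF tF mUF; rewrite /prodleb_cons /pushforward preimage_bigcup.
apply: measure_semi_sigma_additive.
- by move=> k; rewrite -[X in measurable X]setTI; exact: measurable_tuple_cons.
- apply/trivIsetP => /= i j _ _ ij; rewrite -preimage_setI.
  by move/trivIsetP : tF => /(_ _ _ _ _ ij) ->//; rewrite preimage_set0.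
- rewrite -preimage_bigcup -[X in measurable X]setTI.
  exact: measurable_tuple_cons.
Qed.

HB.instance Definition _ := isMeasure.Build _ _ _ prodleb_cons
  prodleb_cons0 prodleb_cons_ge0 prodleb_cons_sigma_additive.

Let prodleb_cons_sigma_finite : sigma_finite setT prodleb_cons.
Proof.
have /sigma_finiteP[F [TF ndF Foo]] := sigma_finiteT (@lebesgue_measure R).
have /sigma_finiteP[G [TG ndG Goo]] := sigma_finiteT mu.
exists (fun k => tuple_uncons @^-1` (F k `*` G k)).
  rewrite -preimage_bigcup -[LHS](preimage_setT tuple_uncons) -setXTT TF TG.
  congr (_ @^-1` _); apply/seteqP; split=> -[x y].
    move=> [/= [i _ Fx] [j _ Gy]]; exists (maxn i j) => //; split.
    - by move: x Fx; exact/subsetPset/ndF/leq_maxl.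
    - by move: y Gy; exact/subsetPset/ndG/leq_maxr.
  by move=> [i _ []/= ? ?]; split; exists i.
move=> k; have [mF Fk] := Foo k; have [mG Gk] := Goo k; split.
  rewrite -[X in measurable X]setTI; apply: measurable_tuple_uncons => //.
  exact: measurableX.
rewrite /prodleb_cons /pushforward (_ : _ @^-1` _ = F k `*` G k); last first.
  by apply/funext => z; rewrite -[in RHS](tuple_consK z).
by rewrite product_measure1E// lte_mul_pinfty// ge0_fin_numE.
Qed.

HB.instance Definition _ := Measure_isSigmaFinite.Build _ _ _ prodleb_cons
  prodleb_cons_sigma_finite.

End prodleb_cons.

Fixpoint prodleb (R : realType) (n : nat) :
    {sigma_finite_measure set (n.-tuple (measurableTypeR R)) -> \bar R} :=
  match n with
  | 0 => \d_([tuple] : 0.-tuple (measurableTypeR R))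
  | m.+1 => prodleb_cons (prodleb R m)
  end.

Lemma prodleb_box (R : realType) (n : nat) (A : 'I_n -> set (measurableTypeR R)) :
  (forall i, measurable (A i)) ->
  prodleb R n [set x | forall i, A i (tnth x i)] =
  (\prod_(i < n) lebesgue_measure (A i))%E.
Proof.
elim: n A => [|n IH] A mA.
  by rewrite big_ord0 /= diracE mem_set//= => -[].
have mB : measurable [set x : n.-tuple (measurableTypeR R) |
                       forall i, A (lift ord0 i) (tnth x i)].
  rewrite (_ : mkset _ = \bigcap_(i in [set: 'I_n])
     ((@tnth n (measurableTypeR R) ^~ i) @^-1` A (lift ord0 i))); last first.
    by apply/seteqP; split=> x /= xA => [i _|i]; exact: xA.
  apply: fin_bigcap_measurable => // i _; rewrite -[X in measurable X]setTI.
  exact: measurable_tnth.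
rewrite big_ord_recl -(IH (fun i => A (lift ord0 i)))//.
rewrite -product_measure1E// /= /prodleb_cons /pushforward; congr product_measure1.
apply/seteqP; split=> -[s x] /=.
  move=> xA; split; first exact: (xA ord0).
  by move=> i; have := xA (lift ord0 i); rewrite tnthS.
move=> [sA xA] i; case: (unliftP ord0 i) => [j|] ->; last exact: sA.
by rewrite tnthS; exact: xA.
Qed.

(* Points (x, t) of R^{n+1} are pairs in ['rV[R]_n * R]. The library's norm on
   ['rV[R]_n] is the sup norm; [enorm] is the Euclidean one. *)
Section grushin.
Context (R : realType).

Section space.
Context (n : nat).
Implicit Types (u : 'rV[R]_n * R -> R) (z : 'rV[R]_n * R).

Definition grushin_integral (F : 'rV[R]_n * R -> \bar R) : \bar R :=
  (\int[(prodleb R n \x lebesgue_measure)%E]_z F (\row_i tnth z.1 i, z.2))%E.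

Definition enorm (m : nat) (x : 'rV[R]_m) : R :=
  Num.sqrt (\sum_(i < m) x ord0 i ^+ 2).

Definition hdim : R := n.+2%:R.

Definition partial_x (i : 'I_n) u z : R :=
  'D_((delta_mx ord0 i, 0) : 'rV[R]_n * R) (u : _ -> R^o) z.

Definition partial_t u z : R :=
  'D_((0, 1) : 'rV[R]_n * R) (u : _ -> R^o) z.

Definition rho z : R := (enorm z.1 ^+ 4 + 4 * z.2 ^+ 2) `^ 4^-1.

Definition grushin_grad u z : 'rV[R]_(n + 1) :=
  row_mx (\row_i partial_x i u z) (enorm z.1 * partial_t u z)%:M.

(* [_^-1] and [_ `^ _] are total, so that psi and the operators below get
   arbitrary values at the origin, and quotients by |grad_G rho| do on {x = 0};
   these sets are Lebesgue-negligible. *)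
Definition psi z : R := enorm z.1 ^+ 2 / rho z ^+ 2.

Definition partial_rho u z : R :=
  (rho z)^-1 *
  (\sum_(i < n) z.1 ord0 i * partial_x i u z + 2 * z.2 * partial_t u z).

(* The components are along rho, phi and w, the last one being tangent to the
   sphere S^{n-1}; this is why there are 1 + 1 + (n - 1) of them. *)
Definition radial_grad u z : 'rV[R]_n.+1 :=
  Num.sqrt (psi z) *: (partial_rho u z *: delta_mx ord0 ord0).

Definition radial_lap u z : R :=
  psi z * (partial_rho (partial_rho u) z
           + (hdim - 1) / rho z * partial_rho u z).

End space.

(* C^k and C^oo on a normed module; on a finite-dimensional one they coincide
   with the definition by continuity of the iterated partial derivatives. *)
Fixpoint Ck (V : normedModType R) (k : nat) (f : V -> R^o) : Prop :=
  match k with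
  | 0 => continuous f
  | j.+1 => (forall x, differentiable f x) /\ forall v, Ck j ('D_v f)
  end.

Definition Cc_infty (V : normedModType R) (f : V -> R) : Prop :=
  (forall k, Ck k (f : V -> R^o)) /\ compact (closure [set x | f x != 0]).

End grushin.
Arguments hdim : clear implicits.

(* Main.v *)
From HB Require Import structures.
Require Import Defs.
From mathcomp Require Import all_boot all_order all_algebra.
From mathcomp Require Import all_classical all_reals all_analysis.
From mathcomp Require Import measurable_realfun ring lra.
Import numFieldNormedType.Exports.
Import Order.TTheory GRing.Theory Num.Theory.
Local Open Scope classical_set_scope.
Local Open Scope ring_scope.
Set Implicit Arguments.
Unset Strict Implicit.
Unset Printing Implicit Defensive.

(** Along the anisotropic dilations delta_s (x, t) = (e^s x, e^(2s) t), with
    generator E, one has rho partial_rho = E. With f = E u and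
    K = E f + n f, both integrands become W |f|^p and W |K|^p for the same weight
    W = psi^(p/2) rho^(-2p-beta), and with c = (Q (p - 1) + beta) / p the
    inequality reads c^p int W |f|^p <= int W |K|^p.

    Since f vanishes at the origin, f = int_0^oo e^(-n s) K o delta_(-s) ds.
    Jensen's inequality for the probability density c e^(-c s), Tonelli's theorem and
    the scaling of the integral under delta_s give the inequality; no boundary
    condition at infinity is needed.

    For the sharpness take u radial with E u = e^(-kappa s) y(s), where s = ln rho,
    kappa = n - c, and y = 1 on [1, N] with transition layers of fixed width. Then
    K = e^(-kappa s) (y' + c y), and the density W rho^(-kappa p) is
    homogeneous of degree -Q, so that all shells j <= ln rho < j + 1 have the same mass
    and the quotient of the two integrals tends to c^p as N grows. *)

(** * C^k functions *)

(** The rate c is forced by scaling. After Jensen's inequality the slice at time s carries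
    e^(-(2p+beta)s) from W, e^(-(n-c)ps) from what the density leaves of e^(-ns), and e^(Qs) from
    the change of variables; the product is 1 exactly when cp = Q(p-1) + beta. The same identity,
    read as kappa p = Q - 2p - beta, gives the degree -Q used for the shells. The n in K is Q - 2:
    the second radial derivative is rho^(-2) (E^2 - E), and the lost E is taken off Q - 1. The
    inequality is proved in [0, +oo], where Tonelli's theorem applies whatever the size of the
    integrals. For the sharpness, the ideal E u = rho^(-kappa) is not admissible: it has no compact
    support, and rho is not differentiable at the origin. The profile is therefore constant below a
    positive threshold of ln rho and zero far out. The inner constant may be nonzero, because only E
    u and K enter the integrals, so no mean-zero condition falls on y. *)

Section Ck_calculus.
Context {R : realType} {V : normedModType R}.
Implicit Types (f g : V -> R^o) (U : R^o -> R^o).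

Lemma Ck_continuous k f : Ck k f -> continuous f.
Proof. by case: k => // k [df _] x; exact: differentiable_continuous. Qed.

Lemma CkS_Ck k f : Ck k.+1 f -> Ck k f.
Proof.
elim: k f => [|k IH] f; first exact: Ck_continuous.
by move=> [df Df]; split => // v; exact: IH.
Qed.

Lemma Ck_cst k (a : R) : Ck k (cst a : V -> R^o).
Proof.
elim: k a => [|k IH] a; first exact: cst_continuous.
split=> [x|v]; first exact: differentiable_cst.
rewrite (_ : 'D_v _ = cst 0); last by apply/funext => x; rewrite derive_cst.
exact: IH.
Qed.

Lemma CkD k f g : Ck k f -> Ck k g -> Ck k (f \+ g : V -> R^o).
Proof.
elim: k f g => [|k IH] f g; first by move=> /= cf cg x; exact: (cvgD (cf x) (cg x)).
move=> [df Df] [dg Dg]; split=> [x|v]; first exact: differentiableD.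
rewrite (_ : 'D_v _ = ('D_v f \+ 'D_v g)); first by apply: IH; [exact: Df|exact: Dg].
by apply/funext => x; rewrite deriveD//; exact: diff_derivable.
Qed.

Lemma CkM k f g : Ck k f -> Ck k g -> Ck k (f \* g : V -> R^o).
Proof.
elim: k f g => [|k IH] f g; first by move=> /= cf cg x; exact: (cvgM (cf x) (cg x)).
move=> Cf Cg; have [df Df] := Cf; have [dg Dg] := Cg.
split=> [x|v]; first exact: (differentiableM (df x) (dg x)).
rewrite (_ : 'D_v _ = ((f \* 'D_v g) \+ (g \* 'D_v f))).
  by apply: CkD; apply: IH; (exact: CkS_Ck || exact: Df || exact: Dg).
apply/funext => x; rewrite (@deriveM _ _ f g x v) //; exact: diff_derivable.
Qed.

Lemma Ck_sum k m (F : 'I_m -> V -> R^o) :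
  (forall i, Ck k (F i)) -> Ck k (fun x => \sum_(i < m) F i x : R^o).
Proof.
elim: m F => [|m IH] F CF.
  rewrite (_ : (fun _ => _) = cst 0); first exact: Ck_cst.
  by apply/funext => x; rewrite big_ord0.
rewrite (_ : (fun _ => _) =
    (fun x => \sum_(i < m) F (widen_ord (leqnSn m) i) x) \+ F ord_max).
  by apply: CkD => //; exact: IH.
by apply/funext => x; rewrite big_ord_recr.
Qed.

Lemma derive_comp1 f U x v : differentiable f x -> differentiable U (f x) ->
  'D_v (U \o f) x = 'D_1 U (f x) * 'D_v f x.
Proof.
move=> df dU; rewrite deriveE; last exact: differentiable_comp.
rewrite diff_comp//= -(deriveE _ df) diff1E//= -derive1E.
by rewrite /GRing.scale/= mulrC.
Qed.

Lemma Ck_comp k f U : Ck k f -> Ck k U -> Ck k (U \o f).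
Proof.
elim: k f U => [|k IH] f U.
  by move=> /= cf cU x; apply: continuous_comp; [exact: cf|exact: cU].
move=> Cf CU; have [df Df] := Cf; have [dU DU] := CU.
split=> [x|v]; first exact: differentiable_comp.
rewrite (_ : 'D_v _ = (('D_1 U \o f) \* 'D_v f)).
  by apply: CkM; [apply: IH; [exact: CkS_Ck|exact: DU]|exact: Df].
by apply/funext => x; rewrite derive_comp1.
Qed.

Lemma Ck_linear k (l : {linear V -> R^o}) : continuous l -> Ck k l.
Proof.
case: k => // k cl; split=> [x|v]; first exact: linear_differentiable.
rewrite (_ : 'D_v _ = cst (l v)); first exact: Ck_cst.
apply/funext => x; rewrite deriveE ?diff_lin//; exact: linear_differentiable.
Qed.

End Ck_calculus.

(** * The dilation flow and its generator *)

Section dilation_flow.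
Context {R : realType} {n : nat}.
Local Notation V := ('rV[R]_n * R)%type.
Implicit Types (u f g : V -> R^o) (z v : V) (s : R).

Definition dil (s : R) (z : V) : V := (expR s *: z.1, expR (2 * s) * z.2).

Definition euler (u : V -> R) (z : V) : R :=
  \sum_(i < n) z.1 ord0 i * partial_x i u z + 2 * z.2 * partial_t u z.

(** The vector (x, 2t) is expanded in the coordinate basis, and the differential is linear. *)
Lemma eulerE u z : differentiable u z -> euler u z = 'd u z (z.1, 2 * z.2).
Proof.
move=> du; have -> : (z.1, 2 * z.2) =
    \sum_(i < n) z.1 ord0 i *: (delta_mx ord0 i, 0) + (2 * z.2) *: (0, 1) :> V.
  rewrite [X in X = _]surjective_pairing [RHS]surjective_pairing; congr pair.
    rewrite /= (big_morph fst (id1 := 0) (op1 := +%R))//= scaler0 addr0.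
    exact: row_sum_delta.
  rewrite /= (big_morph snd (id1 := 0) (op1 := +%R))//= big1 ?add0r.
    by rewrite /GRing.scale/= mulr1.
  by move=> i _; rewrite scaler0.
rewrite linearD linear_sum linearZ /euler /partial_x /partial_t /GRing.scale /=.
rewrite -(deriveE _ du); congr (_ + _); apply: eq_bigr => i _.
by rewrite linearZ -(deriveE _ du).
Qed.

Lemma dil0 z : dil 0 z = z.
Proof. by rewrite /dil mulr0 expR0 scale1r mul1r -surjective_pairing. Qed.

Lemma dilD s t z : dil s (dil t z) = dil (s + t) z.
Proof. by rewrite /dil/= scalerA -expRD mulrDr mulrA -expRD. Qed.

(** The velocity is the field (x, 2t) taken at the current point of the orbit, which is what makes
    [dil] the flow of [euler]. *)
Lemma is_diff_dil s z :
  is_diff s (dil ^~ z) (fun h => h *: ((dil s z).1, 2 * (dil s z).2)).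
Proof.
have dE (a : R) : differentiable (fun h : R => expR (a * h) : R) s.
  by apply/derivable1_diffP.
have E1 : differentiable (expR : R -> R) s by exact/derivable1_diffP.
have d1 : differentiable (fun h : R => expR h *: z.1) s.
  exact: differentiableZl.
have d2 : differentiable (fun h : R => (expR (2 * h) * z.2 : R)) s.
  by apply: differentiableM.
apply: DiffDef; first exact: differentiable_pair.
rewrite /dil diff_pair//; apply/funext => h; congr pair => /=.
  rewrite diffZl// diff1E//= derive1E derive_val.
  by rewrite scalerA.
rewrite diff1E//= derive1E derive_val /GRing.scale/=. ring.
Qed.

(** Reduces Euler derivatives to one-variable calculus along an orbit: the product rule with 1/rho,
    the flow representation and the action on radial functions all go through it. *)
Lemma is_derive_dil u s z : differentiable u (dil s z) ->
  is_derive s 1 (fun s => u (dil s z)) (euler u (dil s z)).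
Proof.
move=> du; have dd := is_diff_dil s z.
have duz : differentiable (u \o (dil ^~ z)) s by exact: differentiable_comp.
apply: DeriveDef; first exact: diff_derivable.
rewrite (deriveE _ duz) diff_comp// eulerE//=.
by rewrite diff_val scale1r.
Qed.


Lemma coord1_linear (i : 'I_n) : linear (fun z : V => z.1 ord0 i : R^o).
Proof. by move=> a x y; rewrite !mxE. Qed.

Lemma coord2_linear : linear (fun z : V => z.2 : R^o).
Proof. by []. Qed.

Lemma Ck_coord1 k (i : 'I_n) : Ck k (fun z : V => z.1 ord0 i : R^o).
Proof.
pose l : {linear V -> R^o} :=
  HB.pack (fun z : V => z.1 ord0 i : R^o)
    (GRing.isLinear.Build _ _ _ _ _ (coord1_linear i)).
apply: (@Ck_linear _ _ k l) => z /=.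
apply: (@continuous_comp _ _ _ fst (fun x : 'rV[R]_n => x ord0 i : R^o)).
  exact: cvg_fst.
exact: coord_continuous.
Qed.

Lemma Ck_coord2 k : Ck k (fun z : V => z.2 : R^o).
Proof.
pose l : {linear V -> R^o} :=
  HB.pack (fun z : V => z.2 : R^o)
    (GRing.isLinear.Build _ _ _ _ _ coord2_linear).
apply: (@Ck_linear _ _ k l) => z /=; exact: cvg_snd.
Qed.

Lemma Ck_euler k u : Ck k.+1 u -> Ck k (euler u : V -> R^o).
Proof.
move=> [_ Du]; rewrite /euler.
apply: (@CkD _ _ k (fun z => \sum_(i < n) z.1 ord0 i * partial_x i u z)
  (fun z => 2 * z.2 * partial_t u z)).
  apply: (@Ck_sum _ _ k n (fun i z => z.1 ord0 i * partial_x i u z)) => i.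
  apply: (@CkM _ _ k (fun z => z.1 ord0 i) (partial_x i u)).
    exact: Ck_coord1.
  exact: Du.
apply: (@CkM _ _ k (fun z => 2 * z.2) (partial_t u)); last exact: Du.
apply: (@CkM _ _ k (cst 2) (fun z => z.2)); first exact: Ck_cst.
exact: Ck_coord2.
Qed.

End dilation_flow.

(** * The homogeneous norm *)

Section homogeneous_norm.
Context {R : realType} {n : nat}.
Local Notation V := ('rV[R]_n * R)%type.
Implicit Types (u f g : V -> R^o) (z v : V) (s : R).

Definition sqnorm (z : V) : R := \sum_(i < n) z.1 ord0 i ^+ 2.

(** The fourth power of [rho] is a polynomial, hence smooth at the origin as well; differentiation
    of [rho] and of radial functions passes through it. *)
Definition rho4 (z : V) : R := sqnorm z ^+ 2 + 4 * z.2 ^+ 2.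

Lemma sqnorm_ge0 z : 0 <= sqnorm z.
Proof. by apply: sumr_ge0 => i _; exact: sqr_ge0. Qed.

Lemma enorm_sqr z : enorm z.1 ^+ 2 = sqnorm z.
Proof. by rewrite /enorm sqr_sqrtr// sqnorm_ge0. Qed.

Lemma rho4_ge0 z : 0 <= rho4 z.
Proof. by rewrite /rho4 addr_ge0 ?sqr_ge0// mulr_ge0 ?sqr_ge0. Qed.

Lemma rhoE z : rho z = rho4 z `^ 4^-1.
Proof. by rewrite /rho /rho4 -enorm_sqr -exprM. Qed.

Lemma rho_ge0 z : 0 <= rho z.
Proof. by rewrite /rho powR_ge0. Qed.

Lemma rho_exp4 z : rho z ^+ 4 = rho4 z.
Proof. by rewrite rhoE -powR_mulrn ?powR_ge0// -powRrM mulVf// powRr1 ?rho4_ge0. Qed.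

Lemma rho_eq0 z : (rho z == 0) = (rho4 z == 0).
Proof. by rewrite -rho_exp4 expf_eq0. Qed.

Lemma rho_gt0 z : (0 < rho z) = (0 < rho4 z).
Proof. by rewrite !lt0r rho_eq0 rho_ge0 rho4_ge0. Qed.

Lemma psiE z : psi z = sqnorm z / rho z ^+ 2.
Proof. by rewrite /psi enorm_sqr. Qed.

Lemma psi_ge0 z : 0 <= psi z.
Proof. by rewrite psiE divr_ge0 ?sqnorm_ge0// sqr_ge0. Qed.

Lemma sqnorm_dil s z : sqnorm (dil s z) = expR (2 * s) * sqnorm z.
Proof.
rewrite /sqnorm mulr_sumr; apply: eq_bigr => i _.
by rewrite /= mxE exprMn mulrC -expRM_natl mulrC.
Qed.

Lemma rho4_dil s z : rho4 (dil s z) = expR (4 * s) * rho4 z.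
Proof.
rewrite /rho4 sqnorm_dil/= !exprMn -!expRM_natl mulrA.
by rewrite -natrM mulrDr; congr (_ + _); rewrite mulrCA.
Qed.

Lemma rho_dil s z : rho (dil s z) = expR s * rho z.
Proof.
rewrite !rhoE rho4_dil powRM ?expR_ge0 ?rho4_ge0// -expRM.
by congr (expR _ * _); rewrite mulrAC mulfV// mul1r.
Qed.

Lemma psi_dil s z : psi (dil s z) = psi z.
Proof.
rewrite !psiE sqnorm_dil rho_dil exprMn -expRM_natl.
by rewrite -mulf_div mulfV ?mul1r// gt_eqF ?expR_gt0.
Qed.

Lemma Ck_sqnorm k : Ck k (sqnorm : V -> R^o).
Proof.
apply: (@Ck_sum _ _ k n (fun i z => z.1 ord0 i ^+ 2)) => i.
apply: (@CkM _ _ k (fun z => z.1 ord0 i) (fun z => z.1 ord0 i)); exact: Ck_coord1.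
Qed.

Lemma Ck_rho4 k : Ck k (rho4 : V -> R^o).
Proof.
apply: (@CkD _ _ k (fun z => sqnorm z ^+ 2) (fun z => 4 * z.2 ^+ 2)).
  by apply: (@CkM _ _ k sqnorm sqnorm); exact: Ck_sqnorm.
apply: (@CkM _ _ k (cst 4) (fun z => z.2 ^+ 2)); first exact: Ck_cst.
by apply: (@CkM _ _ k (fun z => z.2) (fun z => z.2)); exact: Ck_coord2.
Qed.

Lemma derive_sqnorm v z :
  'D_v (sqnorm : V -> R^o) z = \sum_(i < n) 2 * z.1 ord0 i * v.1 ord0 i.
Proof.
have dc i : is_derive z v (fun z : V => z.1 ord0 i : R^o) (v.1 ord0 i).
  pose l : {linear V -> R^o} :=
    HB.pack (fun z : V => z.1 ord0 i : R^o)
      (GRing.isLinear.Build _ _ _ _ _ (@coord1_linear R n i)).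
  have dl : differentiable l z by have [+ _] := @Ck_coord1 R n 1 i; apply.
  apply: DeriveDef; first exact: (diff_derivable dl).
  rewrite (deriveE v dl) (diff_lin (f := l))//.
  exact: (@Ck_continuous _ _ 0 _ (@Ck_coord1 R n 0 i)).
have -> : (sqnorm : V -> R^o) =
    \sum_(i < n) (fun z : V => z.1 ord0 i : R^o) ^+ 2.
  by apply/funext => x; rewrite /sqnorm fct_sumE.
rewrite derive_val; apply: eq_bigr => i _.
rewrite /GRing.scale/= expr1 -mulr_natl; ring.
Qed.

Lemma derive_rho4 v z : 'D_v (rho4 : V -> R^o) z =
  2 * sqnorm z * 'D_v (sqnorm : V -> R^o) z + 8 * z.2 * v.2.
Proof.
have dc : is_derive z v (fun z : V => z.2 : R^o) v.2.
  pose l : {linear V -> R^o} :=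
    HB.pack (fun z : V => z.2 : R^o)
      (GRing.isLinear.Build _ _ _ _ _ (@coord2_linear R n)).
  have dl : differentiable l z by have [+ _] := @Ck_coord2 R n 1; apply.
  apply: DeriveDef; first exact: (diff_derivable dl).
  rewrite (deriveE v dl) (diff_lin (f := l))//.
  exact: (@Ck_continuous _ _ 0 _ (@Ck_coord2 R n 0)).
have ds : is_derive z v (sqnorm : V -> R^o) ('D_v (sqnorm : V -> R^o) z).
  apply: derivableP; apply: diff_derivable.
  by have [+ _] := Ck_sqnorm 1; apply.
have := is_deriveD (is_deriveM ds ds) (is_deriveZ 4 (is_deriveM dc dc)).
move=> /(@derive_val _ _ _ _ _ _ _) H.
transitivity ('D_v (sqnorm * sqnorm + 4 *: ((fun z : V => z.2) * (fun z : V => z.2)) : V -> R^o) z).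
  by congr ('D_v _ z); apply/funext => x.
rewrite H /GRing.scale/=; ring.
Qed.

Lemma differentiable_powR (a r : R) : 0 < r ->
  differentiable ((fun x => x `^ a) : R^o -> R^o) r.
Proof.
move=> r0; apply/derivable1_diffP; apply: derivable_powR.
by rewrite in_itv/= r0.
Qed.

Lemma differentiable_rho z : 0 < rho4 z -> differentiable (@rho R n : V -> R^o) z.
Proof.
move=> z0; have -> : (@rho R n : V -> R^o) = ((fun x => x `^ 4^-1) : R^o -> R^o) \o rho4.
  by apply/funext => x; rewrite rhoE.
apply: differentiable_comp; first by have [+ _] := Ck_rho4 1; apply.
exact: differentiable_powR.
Qed.

Lemma derive_rho v z : 0 < rho4 z -> 'D_v (@rho R n : V -> R^o) z =
  4^-1 * rho z ^- 3 * 'D_v (rho4 : V -> R^o) z.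
Proof.
move=> z0; have -> : (@rho R n : V -> R^o) = ((fun x => x `^ 4^-1) : R^o -> R^o) \o rho4.
  by apply/funext => x; rewrite rhoE.
rewrite derive_comp1; last 2 first.
- by have [+ _] := Ck_rho4 1; apply.
- exact: differentiable_powR.
rewrite -derive1E powR_derive1 ?in_itv/= ?z0//; congr (_ * _ * _).
by rewrite -powR_invn ?powR_ge0// -powRrM; congr (_ `^ _); lra.
Qed.

Lemma partial_x_rho (i : 'I_n) z : 0 < rho4 z ->
  partial_x i (@rho R n) z = rho z ^- 3 * sqnorm z * z.1 ord0 i.
Proof.
move=> z0; rewrite /partial_x derive_rho// derive_rho4 derive_sqnorm.
rewrite (bigD1 i)//= big1 => [|j ji]; last first.
  by rewrite mxE eqxx (negbTE ji) mulr0.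
rewrite mxE !eqxx/= mulr1n; have : rho z != 0 by rewrite gt_eqF// rho_gt0.
by move=> r0 /=; field.
Qed.

Lemma partial_t_rho z : 0 < rho4 z ->
  partial_t (@rho R n) z = rho z ^- 3 * (2 * z.2).
Proof.
move=> z0; rewrite /partial_t derive_rho// derive_rho4 derive_sqnorm.
rewrite big1 => [|i _]; last by rewrite mxE mulr0.
have : rho z != 0 by rewrite gt_eqF// rho_gt0.
by move=> r0 /=; field.
Qed.

Lemma enorm_grushin_grad_rho z : 0 < rho4 z ->
  enorm (grushin_grad (@rho R n) z) = Num.sqrt (psi z).
Proof.
move=> z0; rewrite {1}/enorm; congr Num.sqrt.
have r0 : rho z != 0 by rewrite gt_eqF// rho_gt0.
rewrite big_split_ord/= big_ord1 /grushin_grad row_mxEr mxE eqxx mulr1n.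
rewrite partial_t_rho//.
transitivity (\sum_(i < n) (rho z ^- 6 * sqnorm z ^+ 2) * z.1 ord0 i ^+ 2 +
   rho z ^- 6 * (4 * z.2 ^+ 2) * sqnorm z).
  congr (_ + _); last by rewrite -enorm_sqr; field.
  by apply: eq_bigr => i _; rewrite row_mxEl mxE partial_x_rho//; field.
rewrite -mulr_sumr -/(sqnorm z) psiE.
(* The x and t parts share the factor |x|^2 rho^(-6); what remains is |x|^4 + 4 t^2 = rho^4. *)
transitivity (rho z ^- 6 * sqnorm z * rho z ^+ 4); last by field.
by rewrite rho_exp4 /rho4; ring.
Qed.

Lemma partial_rhoE u z : partial_rho u z = (rho z)^-1 * euler u z.
Proof. by []. Qed.

(** Along an orbit 1/rho becomes e^(-s)/rho, so the product rule contributes the extra - f. *)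
Lemma partial_rho2E f z : 0 < rho4 z -> differentiable f z ->
  euler (fun z => (rho z)^-1 * f z) z = (rho z)^-1 * (euler f z - f z).
Proof.
move=> z0 df; have r0 : rho z != 0 by rewrite gt_eqF// rho_gt0.
have dr : differentiable (fun z => (rho z)^-1 * f z : R^o) z.
  apply: differentiableM => //; apply: differentiableV => //.
  exact: differentiable_rho.
have := @is_derive_dil R n (fun z => (rho z)^-1 * f z) 0 z.
rewrite dil0 => /(_ dr) D1.
have := @is_derive_dil R n f 0 z.
rewrite dil0 => /(_ df) D2.
rewrite -(@derive_val _ _ _ _ _ _ _ D1).
have -> : (fun s => (rho (dil s z))^-1 * f (dil s z)) =
  (rho z)^-1 *: ((fun s => expR (- s)) * (fun s => f (dil s z))).
  by apply/funext => s; rewrite !fctE rho_dil invfM expRN /GRing.scale/=; ring.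
rewrite derive_val dil0 oppr0 expR0 /GRing.scale/=; ring.
Qed.

Definition hardy_weight (p beta : R) (z : V) : R :=
  Num.sqrt (psi z) `^ p * rho z `^ (- (2 * p + beta)).

Definition hardy_source (u : V -> R) (z : V) : R :=
  euler (euler u) z + n%:R * euler u z.

(** With the convention that 0 has inverse 0, [psi] and hence the weight vanish at the origin; the
    integrand identities below then hold at every point, without an almost-everywhere argument. *)
Lemma rho_eq0_psi z : rho z = 0 -> psi z = 0.
Proof. by rewrite psiE => ->; rewrite expr0n/= invr0 mulr0. Qed.

Lemma enorm_radial_grad u z :
  enorm (radial_grad u z) = Num.sqrt (psi z) * ((rho z)^-1 * `|euler u z|).
Proof.
rewrite /enorm /radial_grad (bigD1 ord0)//= big1 ?addr0; last first.
  by move=> i i0; rewrite !mxE (negbTE i0) !mulr0 expr0n.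
rewrite !mxE !eqxx mulr1 sqrtr_sqr normrM ger0_norm ?sqrtr_ge0//.
by rewrite partial_rhoE normrM ger0_norm// invr_ge0 rho_ge0.
Qed.

Lemma invr_powR (r p : R) : 0 <= r -> r^-1 `^ p = r `^ (- p).
Proof. by move=> r0; rewrite -powR_inv1// -powRrM mulN1r. Qed.

Lemma grad_integrandE p beta u z : p != 0 ->
  enorm (radial_grad u z) `^ p / rho z `^ (p + beta) =
  hardy_weight p beta z * `|euler u z| `^ p.
Proof.
move=> p0; rewrite enorm_radial_grad /hardy_weight.
have [r0|r0] := eqVneq (rho z) 0.
  by rewrite (rho_eq0_psi r0) sqrtr0 mul0r powR0// !mul0r.
rewrite powRM ?sqrtr_ge0 ?mulr_ge0 ?invr_ge0 ?rho_ge0//.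
rewrite powRM ?invr_ge0 ?rho_ge0// invr_powR ?rho_ge0//.
rewrite -powRN -!mulrA; congr (_ * _); rewrite mulrCA mulrC; congr (_ * _).
by rewrite -powRD ?r0 ?implybT//; congr (_ `^ _); ring.
Qed.

Lemma radial_lapE u z : Ck 2 u -> 0 < rho4 z ->
  radial_lap u z = psi z * ((rho z) ^- 2 * hardy_source u z).
Proof.
move=> Cu z0; rewrite /radial_lap; congr (_ * _).
have r0 : rho z != 0 by rewrite gt_eqF// rho_gt0.
have -> : partial_rho u = (fun z => (rho z)^-1 * euler u z) by [].
rewrite partial_rhoE partial_rho2E//; last first.
  by have [+ _] := @Ck_euler _ _ 1 _ Cu; apply.
by rewrite /hardy_source /hdim -natr1; field.
Qed.

(** Half of psi^p is cancelled by |grad_G rho|^p = psi^(p/2), which leaves the weight of the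
    gradient side. Where [psi] is zero, that is on the axis x = 0, both sides are 0. *)
Lemma lap_integrandE p beta u z : p != 0 -> Ck 2 u ->
  `|radial_lap u z| `^ p /
     (enorm (grushin_grad (@rho R n) z) `^ p * rho z `^ beta) =
  hardy_weight p beta z * `|hardy_source u z| `^ p.
Proof.
move=> p0 Cu; rewrite /hardy_weight.
have [psi0|psi0] := eqVneq (psi z) 0.
  by rewrite /radial_lap psi0 mul0r normr0 sqrtr0 powR0// !mul0r.
have r0 : 0 < rho z.
  rewrite lt0r rho_ge0 andbT; apply: contra psi0 => /eqP r0.
  by rewrite (rho_eq0_psi r0).
have z0 : 0 < rho4 z by rewrite -rho_gt0.
rewrite enorm_grushin_grad_rho// radial_lapE// -{1}(sqr_sqrtr (psi_ge0 z)).
have a0 : 0 < Num.sqrt (psi z) by rewrite sqrtr_gt0 lt0r psi0 psi_ge0.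
set a := Num.sqrt (psi z) in a0 *.
have r2 : 0 <= rho z ^+ 2 := sqr_ge0 _.
have r2V : 0 <= rho z ^- 2 by rewrite invr_ge0.
rewrite normrM (ger0_norm (sqr_ge0 a)) normrM (ger0_norm r2V).
have am : (a ^+ 2) `^ p = a `^ p * a `^ p by rewrite -powRM ?ltW.
rewrite (powRM _ (sqr_ge0 a)) ?mulr_ge0// am.
rewrite (powRM _ r2V)// invr_powR//.
have -> : rho z `^ (- (2 * p + beta)) = (rho z ^+ 2) `^ (- p) / rho z `^ beta.
  rewrite -powR_mulrn ?rho_ge0// -powRrM -powRN -powRD ?(gt_eqF r0) ?implybT//.
  by congr (_ `^ _); ring.
have := powR_gt0 p a0; have := powR_gt0 beta r0 => b1 b2.
by field; rewrite !gt_eqF.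
Qed.

Lemma hardy_weight_ge0 p beta z : 0 <= hardy_weight p beta z.
Proof. by rewrite mulr_ge0 ?powR_ge0. Qed.

Lemma hardy_weight_dil p beta s z :
  hardy_weight p beta (dil s z) = expR (- ((2 * p + beta) * s)) * hardy_weight p beta z.
Proof.
rewrite /hardy_weight psi_dil rho_dil powRM ?expR_ge0 ?rho_ge0// -expRM mulrCA.
by congr (expR _ * _); ring.
Qed.

End homogeneous_norm.

(** * Measurability and scaling *)

Section measurability.
Context {R : realType} {n : nat}.
Local Notation V := ('rV[R]_n * R)%type.
Local Notation T := (n.-tuple (measurableTypeR R) * measurableTypeR R)%type.

Lemma rat_dist_lt (x e : R) : 0 < e -> exists q : rat, `|x - ratr q| < e.
Proof.
move=> e0; have [|q] := @rat_in_itvoo R (x - e) (x + e); first by lra.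
by rewrite in_itv/= => /andP[? ?]; exists q; rewrite ltr_norml; lra.
Qed.

Lemma dist_lt_split (a b q d e : R) :
  `|a - q| < d -> `|b - q| < d -> 2 * d < e -> `|a - b| < e.
Proof. by rewrite !ltr_norml => /andP[? ?] /andP[? ?] ?; apply/andP; lra. Qed.

(** An open set is the union of the boxes it contains with rational centre and radius 1/(k+1). These
    are countably many, and each pulls back under g to finitely many coordinate conditions. The
    domain X is left general so as to cover both points and points paired with a flow time. *)
Lemma measurable_continuous_comp d (X : measurableType d) (g : X -> V)
    (F : V -> R^o) :
  (forall i, measurable_fun setT (fun x => (g x).1 ord0 i : R)) ->
  measurable_fun setT (fun x => (g x).2 : R) ->
  continuous F -> measurable_fun setT (F \o g : X -> R).
Proof.
move=> mg1 mg2 cF; apply: (measurability _ (RGenOpens.measurableE R)).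
move=> _ [_ [a [b ->] <-]]; rewrite setTI.
set O : set V := F @^-1` `]a, b[.
have oO : open O by move/continuousP : cF; apply; exact: interval_open.
pose box (q : 'rV[rat]_n * rat * nat) : set V :=
  [set z : V | (forall i, `|z.1 ord0 i - ratr (q.1.1 ord0 i)| < q.2.+1%:R^-1) /\
           `|z.2 - ratr q.1.2| < q.2.+1%:R^-1].
have -> : (F \o g) @^-1` `]a, b[ =
    \bigcup_(q in [set q | box q `<=` O]) g @^-1` box q.
  apply/seteqP; split=> [x /= Ox|x [q /= qO]]; last exact: qO.
  have /nbhs_ballP[e /= e0 eO] : nbhs (g x) O by move: oO; rewrite openE; exact.
  (* The box is centred within 1/(k+1) of g x and has radius 1/(k+1), so it lies in the e-ball once
     2/(k+1) < e. *)
  pose k := Num.truncn (2 / e).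
  have ke : 2 * k.+1%:R^-1 < e.
    rewrite ltr_pdivrMr// mulrC -ltr_pdivrMr//; exact: truncnS_gt.
  have k0 : 0 < k.+1%:R^-1 :> R by rewrite invr_gt0.
  have /choice[c cx] : forall i, exists q : rat,
    `|(g x).1 ord0 i - ratr q| < k.+1%:R^-1 by move=> i; exact: rat_dist_lt.
  have [c2 c2x] := rat_dist_lt (g x).2 k0.
  exists (\row_i c i, c2, k); last by split => //= i; rewrite mxE.
  move=> z /= [z1 z2]; apply: eO; split => /=.
    split=> // i j; rewrite (ord1 i) /ball/=.
    by apply: dist_lt_split (cx j) _ ke; have := z1 j; rewrite mxE.
  by rewrite /ball/=; exact: dist_lt_split c2x z2 ke.
rewrite bigcup_mkcond; apply: countable_bigcupT_measurable => //.
move=> q; case: ifPn => // _.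
rewrite (_ : g @^-1` _ = (\bigcap_(i in [set: 'I_n])
    (fun x => `|(g x).1 ord0 i - ratr (q.1.1 ord0 i)|) @^-1` `]-oo, q.2.+1%:R^-1[) `&`
    (fun x => `|(g x).2 - ratr q.1.2|) @^-1` `]-oo, q.2.+1%:R^-1[).
  apply: measurableI.
    apply: fin_bigcap_measurable => // i _; rewrite -[X in measurable X]setTI.
    have : measurable_fun setT (fun x => `|(g x).1 ord0 i - ratr (q.1.1 ord0 i)| : R).
      by apply: measurableT_comp => //; exact: measurable_funB.
    exact.
  rewrite -[X in measurable X]setTI.
  have : measurable_fun setT (fun x => `|(g x).2 - ratr q.1.2| : R).
    by apply: measurableT_comp => //; exact: measurable_funB.
  exact.
apply/seteqP; split => [x [/= x1 x2]|x [/= x1 x2]].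
  by split=> [i _|]; rewrite /= in_itv/=.
split=> [i|]; last by move: x2; rewrite in_itv/=.
by have := x1 i I; rewrite /= in_itv/=.
Qed.

(** The identification of the measurable carrier with the normed space that is built into
    [grushin_integral]. *)
Definition tuple_point (z : T) : V := (\row_i tnth z.1 i, z.2).

Lemma measurable_tuple_point (F : V -> R^o) : continuous F ->
  measurable_fun setT (F \o tuple_point : T -> R).
Proof.
apply: measurable_continuous_comp => [i|]; last exact: measurable_snd.
rewrite (_ : (fun _ => _) = (fun x => tnth x i) \o fst).
  by apply: measurableT_comp => //; exact: measurable_tnth.
by apply/funext => z; rewrite /= mxE.
Qed.

Lemma measurable_sqnorm : measurable_fun setT (@sqnorm R n \o tuple_point : T -> R).
Proof. by apply: measurable_tuple_point; exact: (@Ck_sqnorm R n 0). Qed.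

Lemma measurable_rho : measurable_fun setT (@rho R n \o tuple_point : T -> R).
Proof.
rewrite (_ : _ \o _ = (fun r => r `^ 4^-1) \o (@rho4 R n \o tuple_point)).
  apply: measurableT_comp; first exact: measurable_powR.
  by apply: measurable_tuple_point; exact: (@Ck_rho4 R n 0).
by apply/funext => z; rewrite /= rhoE.
Qed.

Lemma measurable_psi : measurable_fun setT (@psi R n \o tuple_point : T -> R).
Proof.
rewrite (_ : _ \o _ = (fun z => sqnorm (tuple_point z) *
    ((fun r : R => r ^- 2) (rho (tuple_point z))))).
  apply: measurable_funM; first exact: measurable_sqnorm.
  apply: (measurableT_comp (f := fun r : R => r ^- 2)); last exact: measurable_rho.
  (* The absolute value makes the real power agree with the integer power at negative r. *)
  rewrite (_ : (fun r : R => r ^- 2) = (fun r : R => (`|r| `^ (- 2)))).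
    by apply: (measurableT_comp (f := fun r : R => r `^ (- 2))) => //; exact: measurable_powR.
  by apply/funext => r; rewrite powR_invn// -normrX ger0_norm// sqr_ge0.
by apply/funext => z; rewrite /= psiE.
Qed.

Lemma measurable_hardy_weight p beta :
  measurable_fun setT (@hardy_weight R n p beta \o tuple_point : T -> R).
Proof.
apply: measurable_funM.
  apply: (measurableT_comp (f := fun r : R => Num.sqrt r `^ p)).
    apply: (measurableT_comp (f := fun r : R => r `^ p)); first exact: measurable_powR.
    apply: continuous_measurable_fun; exact: sqrt_continuous.
  exact: measurable_psi.
apply: (measurableT_comp (f := fun r : R => r `^ _)); first exact: measurable_powR.
exact: measurable_rho.
Qed.

End measurability.

(** * Scaling of the Lebesgue integral on R and R^n *)

Section scaling.
Context {R : realType}.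
Local Notation leb := (@lebesgue_measure R).
Local Notation mR := (measurableTypeR R).
Local Open Scope ereal_scope.

Lemma measurable_scale (l : R) : measurable_fun [set: mR] (fun s : mR => (l * s)%R : mR).
Proof. by apply: measurable_funM => //; exact: measurable_cst. Qed.

(** The right-hand side is a measure, l times an image of Lebesgue measure, and has the right value
    on half-open intervals; uniqueness of Lebesgue measure concludes. *)
Lemma lebesgue_measure_scale (l : R) (l0 : (0 < l)%R) (A : set mR) : measurable A ->
  leb A = l%:E * leb ((fun s : mR => (l * s)%R) @^-1` A).
Proof.
move=> mA; pose m : {measure set mR -> \bar R} :=
  mscale (NngNum (ltW l0))
   (measure_function_pushforward__canonical__measure_function_Measure leb
     (measurable_scale l)).
apply: (@lebesgue_measure_unique _ m) => // _ [[a b] _ <-].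
have -> : m `]a, b]%classic = l%:E * leb `](a / l)%R, (b / l)%R]%classic.
  rewrite /m/= /mscale/= /pushforward; congr (_ * leb _).
  apply/seteqP; split => s /=; rewrite !in_itv/= ltr_pdivrMr// ler_pdivlMr//;
    by rewrite mulrC.
rewrite !lebesgue_measure_itv/= !lte_fin ltr_pM2r ?invr_gt0//.
case: ifPn; last by rewrite mule0.
by rewrite -!EFinB -EFinM -mulrBl mulrCA mulfV ?mulr1// gt_eqF.
Qed.

Lemma ge0_integral_scale (l : R) (F : mR -> \bar R) : (0 < l)%R ->
  measurable_fun setT F -> (forall s, 0 <= F s) ->
  \int[leb]_s F (l * s)%R = l^-1%:E * \int[leb]_s F s.
Proof.
move=> l0 mF F0.
pose pm := measure_function_pushforward__canonical__measure_function_Measure leb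
     (measurable_scale l).
have -> : \int[leb]_s F s = \int[mscale (NngNum (ltW l0)) pm]_s F s.
  by apply: eq_measure_integral => A mA _; exact: lebesgue_measure_scale.
rewrite ge0_integral_mscale//= ge0_integral_pushforward//; last exact: measurable_scale.
by rewrite muleA -EFinM mulVf ?gt_eqF// mul1e preimage_setT.
Qed.

Lemma measurable_map_tuple n (l : R) : measurable_fun [set: n.-tuple mR]
  (fun x : n.-tuple mR => [tuple of map (fun s => (l * s)%R : mR) x]).
Proof.
apply/measurable_fun_tnthP => i.
rewrite (_ : _ \o _ = (fun s : mR => (l * s)%R : mR) \o (fun x => tnth x i)).
  by apply: measurableT_comp; [exact: measurable_scale|exact: measurable_tnth].
by apply/funext => x; rewrite /= tnth_map.
Qed.

Lemma ge0_integral_prodlebS n (F : n.+1.-tuple mR -> \bar R) :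
  measurable_fun setT F -> (forall x, 0 <= F x) ->
  \int[prodleb R n.+1]_x F x =
  \int[leb]_s \int[prodleb R n]_x F (tuple_cons (s, x)).
Proof.
move=> mF F0; rewrite /= /prodleb_cons ge0_integral_pushforward//; last first.
  exact: measurable_tuple_cons.
rewrite preimage_setT fubini_tonelli1//; last by move=> z; exact: F0.
by apply: measurableT_comp => //; exact: measurable_tuple_cons.
Qed.

(** By induction on n, Tonelli's theorem splits off the first coordinate, and each coordinate
    contributes a factor 1/l. *)
Lemma ge0_integral_prodleb_scale n (l : R) (F : n.-tuple mR -> \bar R) :
  (0 < l)%R -> measurable_fun setT F -> (forall x, 0 <= F x) ->
  \int[prodleb R n]_x F [tuple of map (fun s => (l * s)%R : mR) x] =
  (l ^- n)%:E * \int[prodleb R n]_x F x.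
Proof.
move=> l0; elim: n F => [|n IH] F mF F0.
  rewrite invr1 mul1e; apply: eq_integral => x _; congr F.
  by rewrite tuple0 [RHS]tuple0.
have mFl := measurableT_comp mF (measurable_map_tuple (n := n.+1) l).
have mFc := measurableT_comp mF (@measurable_tuple_cons R n).
rewrite !ge0_integral_prodlebS//.
pose G (s : mR) := \int[prodleb R n]_x F (tuple_cons (s, x)).
have mG : measurable_fun setT G.
  apply: (measurable_fun_fubini_tonelli_F (F \o @tuple_cons R n)) => //.
  by move=> z; exact: F0.
have G0 s : 0 <= G s by apply: integral_ge0.
transitivity (\int[leb]_s ((l ^- n)%:E * G (l * s)%R)).
  apply: eq_integral => s _; rewrite -IH//; last first.
    exact: (measurableT_comp mFc (measurable_pair1 (l * s)%R)).
  by apply: eq_integral => x _; congr F; apply/val_inj.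
rewrite ge0_integralZl//; last 2 first.
- exact: measurableT_comp mG (measurable_scale l).
- by rewrite lee_fin invr_ge0 exprn_ge0// ltW.
by rewrite ge0_integral_scale// muleA -EFinM -invfM -exprSr.
Qed.

End scaling.

Section dilation_change_of_variables.
Context {R : realType} {n : nat}.
Local Notation V := ('rV[R]_n * R)%type.
Local Notation T := (n.-tuple (measurableTypeR R) * measurableTypeR R)%type.
Local Notation leb := (@lebesgue_measure R).
Local Open Scope ereal_scope.

(** The n coordinates of x are stretched by e^s and t by e^(2s): the Jacobian e^((n+2)s) is where
    the homogeneous dimension comes from. *)
Lemma grushin_integral_dil (s : R) (F : V -> \bar R) :
  measurable_fun setT (F \o @tuple_point R n : T -> \bar R) -> (forall z, 0 <= F z) ->
  grushin_integral (fun z => F (dil s z)) =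
  (expR (- (hdim R n * s)))%:E * grushin_integral F.
Proof.
move=> mF F0; rewrite /grushin_integral.
pose G : T -> \bar R := F \o @tuple_point R n.
have mdil : measurable_fun [set: T] (fun z : T =>
    ([tuple of map (fun r => (expR s * r)%R : measurableTypeR R) z.1],
     (expR (2 * s) * z.2)%R) : T).
  apply/measurable_fun_pairP; split.
    exact: measurableT_comp (measurable_map_tuple _) measurable_fst.
  exact: measurableT_comp (measurable_scale _) measurable_snd.
transitivity (\int[prodleb R n \x leb]_z
  G ([tuple of map (fun r => (expR s * r)%R : measurableTypeR R) z.1],
     (expR (2 * s) * z.2)%R)).
  apply: eq_integral => z _; rewrite /G/= /tuple_point /dil/=; congr (F (_, _)).
  by apply/rowP => i; rewrite !mxE tnth_map.
have -> : \int[(prodleb R n \x leb)%E]_z F (\row_i tnth z.1 i, z.2) =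
   \int[(prodleb R n \x leb)%E]_z G z by [].
pose H (x : n.-tuple (measurableTypeR R)) := \int[leb]_t G (x, t).
have G0 z : 0 <= G z by exact: F0.
have mH : measurable_fun setT H by exact: measurable_fun_fubini_tonelli_F.
have H0 x : 0 <= H x by apply: integral_ge0 => t _; exact: F0.
rewrite !fubini_tonelli1//; last exact: measurableT_comp mF mdil.
rewrite /fubini_F/=.
transitivity (\int[prodleb R n]_x ((expR (2 * s))^-1%:E *
   H [tuple of map (fun r => (expR s * r)%R : measurableTypeR R) x])).
  apply: eq_integral => x _; rewrite -ge0_integral_scale ?expR_gt0//.
  exact: measurableT_comp mF (measurable_pair1 _).
rewrite ge0_integralZl//; last first.
  exact: (measurableT_comp mH (measurable_map_tuple (expR s))).
rewrite ge0_integral_prodleb_scale ?expR_gt0// muleA -EFinM; congr (_%:E * _).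
rewrite -expRM_natl -!expRN -expRD /hdim; congr expR.
by rewrite -addn2 natrD; ring.
Qed.

End dilation_change_of_variables.

(** * The inequality *)

Section weighted_jensen.
Context {R : realType} d (X : measurableType d) (mu : {measure set X -> \bar R}).

(** The graph of G^p lies above its tangent at a. This is Young's inequality for G and a^(p-1) with
    exponents p and p/(p-1). *)
Lemma young_tangent (a G p : R) : 1 < p -> 0 <= a -> 0 <= G ->
  p * a `^ (p - 1) * G <= G `^ p + (p - 1) * a `^ p.
Proof.
move=> p1 a0 G0; have p0 : 0 < p by lra.
have q0 : 0 < p / (p - 1) by rewrite divr_gt0// subr_gt0.
have := @conjugate_powR R G (a `^ (p - 1)) p (p / (p - 1)) G0 (powR_ge0 _ _) p0 q0.
rewrite -powRrM mulrCA mulfV ?subr_eq0 ?gt_eqF// mulr1.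
have -> : p^-1 + (p / (p - 1))^-1 = 1 by field; lra.
move=> /(_ erefl); rewrite -(ler_pM2l p0) => H.
rewrite -mulrA (mulrC (_ `^ _)) (le_trans H)//.
by rewrite le_eqVlt; apply/orP; left; apply/eqP; field; lra.
Qed.

(** Jensen's inequality by integrating the tangent inequality against E. The tangent is taken at the
    lower bound a rather than at the mean, which may be infinite; its slope is nonnegative, so a
    lower bound on the mean suffices. *)
Lemma integral_powR_ge (E G : X -> R) (a p : R) : 1 < p -> 0 <= a ->
  measurable_fun setT E -> measurable_fun setT G ->
  (forall x, 0 <= E x) -> (forall x, 0 <= G x) ->
  (\int[mu]_x (E x)%:E = 1 ->
  a%:E <= \int[mu]_x (E x * G x)%:E ->
  (a `^ p)%:E <= \int[mu]_x (E x * G x `^ p)%:E)%E.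
Proof.
move=> p1 a0 mE mG E0 G0 E1 aEG; have p0 : 0 < p by lra.
set J := (\int[mu]_x (E x * G x `^ p)%:E)%E.
have J0 : (0 <= J)%E.
  by apply: integral_ge0 => x _; rewrite lee_fin mulr_ge0 ?powR_ge0.
have mGp : measurable_fun setT (fun x => G x `^ p).
  exact: (measurableT_comp (measurable_powR p) mG).
have b0 : 0 <= p * a `^ (p - 1) by rewrite mulr_ge0 ?powR_ge0 ?ltW.
have : ((p * a `^ (p - 1) * a)%:E <= J + ((p - 1) * a `^ p)%:E)%E.
  rewrite EFinM; apply: (@le_trans _ _ (\int[mu]_x ((p * a `^ (p - 1))%:E * (E x * G x)%:E))%E).
    rewrite ge0_integralZl//; first exact: lee_wpmul2l.
    - by apply/measurable_EFinP; exact: measurable_funM.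
    - by move=> x _; rewrite lee_fin mulr_ge0.
  apply: (@le_trans _ _ (\int[mu]_x ((E x * G x `^ p)%:E + ((p - 1) * a `^ p)%:E * (E x)%:E))%E).
    apply: ge0_le_integral => //=.
    - by move=> x _; rewrite -EFinM lee_fin mulr_ge0// mulr_ge0.
    - by apply/measurable_EFinP; do 2 apply: measurable_funM.
    - by apply/measurable_EFinP; apply: measurable_funD; apply: measurable_funM.
    - move=> x _; rewrite -!EFinM -EFinD lee_fin.
      rewrite mulrCA (mulrC _ (E x)) -mulrDr ler_wpM2l//.
      exact: young_tangent.
  rewrite ge0_integralD//; last 4 first.
  - by move=> x _; rewrite lee_fin mulr_ge0 ?powR_ge0.
  - by apply/measurable_EFinP; exact: measurable_funM.
  - by move=> x _; rewrite -EFinM lee_fin !mulr_ge0 ?powR_ge0//; lra.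
  - by apply/measurable_EFinP; exact: measurable_funM.
  rewrite ge0_integralZl//; last 3 first.
  - exact/measurable_EFinP.
  - by move=> x _; rewrite lee_fin.
  - by rewrite lee_fin mulr_ge0 ?powR_ge0//; lra.
  by rewrite E1 mule1.
rewrite -mulrA (mulrC (_ `^ _)) mulr_powRB1//.
(* If J is finite, p a^p <= J + (p - 1) a^p gives the claim by subtraction. *)
by case: J J0 => [J| |]//= _; rewrite ?leey// -EFinD !lee_fin; lra.
Qed.

End weighted_jensen.

(** * The representation of f along orbits of the flow *)

Section hardy_inequality.
Context {R : realType} {n : nat}.
Local Notation V := ('rV[R]_n * R)%type.
Local Notation T := (n.-tuple (measurableTypeR R) * measurableTypeR R)%type.
Local Notation leb := (@lebesgue_measure R).

Lemma cvg_dil_pinfty (z : V) : dil (- s) z @[s --> +oo] --> (0 : V).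
Proof.
have e1 := @cvgr_expR R.
have e2 : expR (2 * - s) @[s --> +oo] --> (0 : R).
  rewrite (_ : (fun s : R => _) = (fun s => expR (- s) * expR (- s))).
    by rewrite -[X in _ --> X](mul0r (0 : R)); apply: cvgM.
  by apply/funext => s; rewrite -expRD; congr expR; ring.
apply: (@cvg_pair _ _ _ _ (nbhs (0 : 'rV[R]_n)) (nbhs (0 : R))).
  by have := cvgZr_tmp (a := z.1) e1; rewrite scale0r; exact.
by have := cvgMr_tmp (b := z.2) e2; rewrite mul0r; exact.
Qed.


(** The origin is the fixed point of the flow; this is the boundary condition that f = [euler u]
    satisfies at the end of every orbit. *)
Lemma euler0 (u : V -> R^o) : euler u 0 = 0.
Proof.
by rewrite /euler big1 ?mulr0 ?mul0r ?addr0// => i _; rewrite mxE mul0r.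
Qed.

Lemma continuous_dil (z : V) : continuous (dil ^~ z).
Proof.
move=> s; have [ds _] := is_diff_dil s z; exact: differentiable_continuous.
Qed.

Lemma continuous_dil_comp (g : V -> R^o) (z : V) : continuous g ->
  continuous (fun s : R => g (dil (- s) z) : R^o).
Proof.
move=> cg s; apply: (@continuous_comp _ _ _ (fun s : R => dil (- s) z) g).
  apply: (@continuous_comp _ _ _ (-%R) (dil ^~ z)); first exact: opp_continuous.
  exact: continuous_dil.
exact: cg.
Qed.

Lemma measurable_dil_comp (g : V -> R^o) (z : V) : continuous g ->
  measurable_fun setT (fun s : R => g (dil (- s) z)).
Proof.
by move=> cg; apply: continuous_measurable_fun; exact: continuous_dil_comp.
Qed.

Lemma continuous_expRNM (a : R) : continuous (fun s : R => expR (- (a * s)) : R).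
Proof.
move=> s; apply: (@continuous_comp _ _ _ (fun s : R => - (a * s))); last exact: continuous_expR.
by apply: continuousN; apply: mulrl_continuous.
Qed.

(* The flow line through z reaches the origin as s tends to infinity, where
   f vanishes; along it, -(e^{-n s} f)' = e^{-n s} (n f + euler f). *)
Lemma flow_representation_le (f : V -> R^o) (z : V) (c : R) : Ck 1 f -> f 0 = 0 ->
  (0 < c)%R ->
  ((c * `|f z|)%:E <= \int[leb]_s (exponential_pdf c s *
     (expR (- ((n%:R - c) * s)) * `|euler f (dil (- s) z) + n%:R * f (dil (- s) z)|))%:E)%E.
Proof.
move=> Cf f0 c0; have cf := Ck_continuous Cf.
set J := (\int[leb]_s _)%E.
set K := fun z => euler f z + n%:R * f z.
have cK : continuous (K : V -> R^o).
  apply: (@CkD _ _ 0 (euler f) (fun z => n%:R * f z)); first exact: (@Ck_euler _ _ 0).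
  by apply: (@CkM _ _ 0 (cst n%:R) f) => //; exact: Ck_cst.
have mJ : measurable_fun setT (fun s => (exponential_pdf c s *
     (expR (- ((n%:R - c) * s)) * `|K (dil (- s) z)|)) : R).
  apply: measurable_funM; first exact: measurable_exponential_pdf.
  apply: measurable_funM.
    by apply: continuous_measurable_fun; exact: continuous_expRNM.
  by apply: measurableT_comp => //; exact: measurable_dil_comp.
have J0 s : 0 <= exponential_pdf c s *
     (expR (- ((n%:R - c) * s)) * `|K (dil (- s) z)|).
  apply: mulr_ge0; first exact/exponential_pdf_ge0/ltW.
  by apply: mulr_ge0; [exact: expR_ge0|exact: normr_ge0].
pose h s : R := expR (- (n%:R * s)) * K (dil (- s) z).
pose H s : R := - (expR (- (n%:R * s)) * f (dil (- s) z)).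
have ch : continuous (h : R -> R).
  move=> s; exact: (cvgM (@continuous_expRNM n%:R s) (@continuous_dil_comp K z cK s)).
have dH (s : R) : is_derive s (1 : R) (H : R -> R) (h s).
  have D1 : is_derive (- s) (1 : R) (fun t : R => f (dil t z)) (euler f (dil (- s) z)).
    by apply: is_derive_dil; have [+ _] := Cf; apply.
  have D2 : is_derive s (1 : R) (fun t : R => f (dil (- t) z)) (- euler f (dil (- s) z)).
    have D0 : is_derive s (1 : R) (-%R : R -> R) (-1) by exact: is_deriveNid.
    have := @is_derive1_comp R (fun t => f (dil t z)) (-%R) s _ _ D1 D0.
    by rewrite mulrN1.
  have -> : H = - ((fun s => expR (- (n%:R * s))) * (fun t => f (dil (- t) z))).
    by [].
  apply: is_derive_eq; rewrite /h /K /GRing.scale/=; ring.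
(* The representation up to time t, with the boundary term at t kept as an error. *)
have FTC (t : R) : 0 < t ->
    ((c * `|f z| - c * (expR (- (n%:R * t)) * `|f (dil (- t) z)|))%:E <= J)%E.
  move=> t0.
  have : (\int[leb]_(s in `[0%R, t]) (h s)%:E = (H t)%:E - (H 0)%:E)%E.
    apply: continuous_FTC2 => //.
    - by apply: continuous_subspaceT.
    - split; [by move=> s _; have [] := dH s| |].
        apply: cvg_at_right_filter; apply: differentiable_continuous.
        by apply/derivable1_diffP; have [] := dH 0.
      apply: cvg_at_left_filter; apply: differentiable_continuous.
      by apply/derivable1_diffP; have [] := dH t.
    - by move=> s _; rewrite derive1E; have [_ ->] := dH s.
  have -> : H 0 = - f z by rewrite /H mulr0 oppr0 expR0 mul1r dil0.
  move=> hE; apply: (@le_trans _ _ (c%:E * \int[leb]_(s in `[0%R, t]) `|(h s)%:E|)%E).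
    apply: (@le_trans _ _ (c%:E * `|\int[leb]_(s in `[0%R, t]) (h s)%:E|)%E); last first.
      apply: lee_wpmul2l; first by rewrite lee_fin ltW.
      apply: le_abse_integral => //; apply/measurable_EFinP.
      by apply: measurable_funTS; exact: continuous_measurable_fun.
    rewrite hE -EFinB abse_EFin -EFinM lee_fin -mulrBr.
    apply: ler_wpM2l; first exact: ltW.
    rewrite /H opprK (addrC (- _) (f z)).
    have := lerB_dist (f z) (expR (- (n%:R * t)) * f (dil (- t) z)).
    by rewrite normrM (ger0_norm (expR_ge0 _)).
  rewrite -ge0_integralZl//; last 2 first.
  - apply: measurableT_comp => //; apply/measurable_EFinP.
    by apply: measurable_funTS; exact: continuous_measurable_fun.
  - by rewrite lee_fin ltW.
  rewrite /J; apply: (@le_trans _ _ (\int[leb]_(s in `[0%R, t]) (exponential_pdf c s *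
     (expR (- ((n%:R - c) * s)) * `|K (dil (- s) z)|))%:E)%E); last first.
    apply: ge0_subset_integral => //; first exact/measurable_EFinP.
    by move=> s _; rewrite lee_fin; exact: J0.
  rewrite le_eqVlt; apply/orP; left; apply/eqP; apply: eq_integral => s.
  rewrite inE/= in_itv/= => /andP[s0 _].
  rewrite exponential_pdfE// /h normrM (ger0_norm (expR_ge0 _)) -EFinM; congr EFin.
  (* The density c e^(-cs) and the factor e^(-(n-c)s) recombine to c e^(-ns). *)
  rewrite mulrA -[RHS]mulrA -mulrA; congr (_ * _); rewrite mulrA -expRD.
  by congr (expR _ * _); ring.
(* The error is at most c |f(dil (-t) z)| because e^(-nt) <= 1, and it tends to c |f 0| = 0 by
   continuity of f. *)
apply/lee_addgt0Pr => e e0.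
have cfd : f (dil (- t) z) @[t --> +oo] --> (0 : R).
  by rewrite -f0; apply: continuous_cvg; [exact: cf|exact: cvg_dil_pinfty].
have : \forall t \near +oo, 0 < t /\ `|f (dil (- t) z)| < e / c.
  near=> t; split; first by near: t; exact: nbhs_pinfty_gt.
  have : `|0 - f (dil (- t) z)| < e / c.
    near: t; move/cvgrPdist_lt : cfd; apply; exact: divr_gt0.
  by rewrite sub0r normrN.
move=> /filter_ex[t [t0 ft]].
have := FTC t t0; rewrite EFinB leeBlDr// => /le_trans; apply.
rewrite leeD2l// lee_fin.
have : expR (- (n%:R * t)) <= 1 by rewrite expR_le1 oppr_le0 mulr_ge0// ltW.
move=> e1; rewrite mulrC -ler_pdivlMr// (le_trans _ (ltW ft))//.
by rewrite ler_piMl.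
Unshelve. all: by end_near. Qed.

End hardy_inequality.

(** * Integration of the orbitwise inequality *)

Section radial_hardy.
Context {R : realType} {n : nat}.
Local Notation V := ('rV[R]_n * R)%type.
Local Notation mR := (measurableTypeR R).
Local Notation T := (n.-tuple mR * mR)%type.
Local Notation leb := (@lebesgue_measure R).

(** The measure behind [grushin_integral] under a name of its own, to which sigma-finiteness is
    attached for Tonelli's theorem against the flow time. *)
Definition point_measure : set T -> \bar R := (prodleb R n \x leb)%E.

HB.instance Definition _ := Measure.on point_measure.

Let point_measure_sigma_finite : sigma_finite setT point_measure.
Proof.
have /sigma_finiteP[F [TF ndF Foo]] := sigma_finiteT (prodleb R n).
have /sigma_finiteP[G [TG ndG Goo]] := sigma_finiteT leb.
exists (fun k => F k `*` G k).
  rewrite -setXTT TF TG; apply/seteqP; split=> -[x y].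
    move=> [/= [i _ Fx] [j _ Gy]]; exists (maxn i j) => //; split.
    - by move: x Fx; exact/subsetPset/ndF/leq_maxl.
    - by move: y Gy; exact/subsetPset/ndG/leq_maxr.
  by move=> [i _ []/= ? ?]; split; exists i.
move=> k; have [? ?] := Foo k; have [? ?] := Goo k.
split; first exact: measurableX.
by rewrite /point_measure product_measure1E// lte_mul_pinfty// ge0_fin_numE.
Qed.

(* The library's sigma-finite instance for products is shadowed by the
   subprobability one. *)
HB.instance Definition _ := Measure_isSigmaFinite.Build _ _ _ point_measure
  point_measure_sigma_finite.

Lemma measurable_dil_tuple_point (g : V -> R^o) : continuous g ->
  measurable_fun setT (fun x : T * mR => g (dil (- x.2) (tuple_point x.1)) : R).
Proof.
move=> cg.
have mexp a : measurable_fun setT (fun x : T * mR => expR (- (a * x.2)) : R).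
  apply: (measurableT_comp (f := fun s : R => expR (- (a * s)))).
    by apply: continuous_measurable_fun; exact: continuous_expRNM.
  exact: measurable_snd.
apply: (measurable_continuous_comp (g := fun x : T * mR =>
  dil (- x.2) (tuple_point x.1))) => // [i|].
  rewrite (_ : (fun _ => _) = (fun x : T * mR => expR (- (1 * x.2)) * tnth x.1.1 i)).
    apply: measurable_funM; last first.
      apply: (measurableT_comp (f := fun y : n.-tuple mR => tnth y i)).
        exact: measurable_tnth.
      exact: measurableT_comp measurable_fst measurable_fst.
    exact: mexp.
  by apply/funext => x; rewrite /= !mxE mul1r.
apply: measurable_funM; last exact: measurableT_comp measurable_snd measurable_fst.
rewrite (_ : (fun _ => _) = (fun x : T * mR => expR (- (2 * x.2)))); first exact: mexp.
by apply/funext => x; rewrite mulrN.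
Qed.

Lemma continuous_hardy_source (u : V -> R^o) : Ck 2 u ->
  continuous (hardy_source u : V -> R^o).
Proof.
move=> Cu; have Cf : Ck 1 (euler u : V -> R^o) by exact: Ck_euler.
apply: (@CkD _ _ 0 (euler (euler u)) (fun z => n%:R * euler u z)).
  exact: (@Ck_euler _ _ 0).
by apply: (@CkM _ _ 0 (cst n%:R) (euler u)); [exact: Ck_cst|exact: CkS_Ck].
Qed.

Lemma measurable_weighted (p beta : R) (g : V -> R^o) : continuous g ->
  measurable_fun setT
    (fun z : T => hardy_weight p beta (tuple_point z) * `|g (tuple_point z)| `^ p).
Proof.
move=> cg; apply: measurable_funM; first exact: measurable_hardy_weight.
apply: (measurableT_comp (measurable_powR p)); apply: measurableT_comp => //.
exact: measurable_tuple_point.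
Qed.

Lemma radial_hardy (u : V -> R^o) (p beta : R) :
  let c := (hdim R n * (p - 1) + beta) / p in
  1 < p -> 0 < c -> Ck 2 u ->
  ((c `^ p)%:E *
     grushin_integral (fun z => (hardy_weight p beta z * `|euler u z| `^ p)%:E) <=
   grushin_integral (fun z => (hardy_weight p beta z * `|hardy_source u z| `^ p)%:E))%E.
Proof.
move=> c p1 c0 Cu; have p0 : 0 < p by lra.
have Cf : Ck 1 (euler u : V -> R^o) by exact: Ck_euler.
have cf : continuous (euler u : V -> R^o) := Ck_continuous Cf.
have cK := continuous_hardy_source Cu.
set W := hardy_weight p beta; set K := hardy_source u.
pose E := exponential_pdf c.
have mE : measurable_fun setT E by exact: measurable_exponential_pdf.
have E0 s : 0 <= E s by exact/exponential_pdf_ge0/ltW.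
pose G z s : R := expR (- ((n%:R - c) * s)) * `|K (dil (- s) z)|.
have G0 z s : 0 <= G z s by rewrite mulr_ge0 ?expR_ge0.
have mG : measurable_fun setT (fun x : T * mR => G (tuple_point x.1) x.2).
  apply: measurable_funM.
    apply: (measurableT_comp (f := fun s : R => expR (- ((n%:R - c) * s)))).
      by apply: continuous_measurable_fun; exact: continuous_expRNM.
    exact: measurable_snd.
  by apply: measurableT_comp => //; exact: measurable_dil_tuple_point.
(* Jensen's inequality on the orbit of each z, multiplied by the weight at z. *)
have pw z : ((W z * (c * `|euler u z|) `^ p)%:E <=
    \int[leb]_s (W z * (E s * G z s `^ p))%:E)%E.
  under eq_integral do rewrite EFinM.
  have mGz : measurable_fun setT (G z).
    apply: measurable_funM.
      by apply: continuous_measurable_fun; exact: continuous_expRNM.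
    by apply: measurableT_comp => //; exact: measurable_dil_comp.
  rewrite ge0_integralZl//; last 3 first.
  - apply/measurable_EFinP; apply: measurable_funM => //.
    exact: (measurableT_comp (measurable_powR p) mGz).
  - by move=> s _; rewrite lee_fin mulr_ge0 ?powR_ge0.
  - by rewrite lee_fin hardy_weight_ge0.
  rewrite EFinM; apply: lee_wpmul2l; first by rewrite lee_fin hardy_weight_ge0.
  apply: integral_powR_ge => //.
  - by rewrite mulr_ge0// ltW.
  - exact: integral_exponential_pdf.
  - by apply: flow_representation_le => //; exact: euler0.
set I := grushin_integral (fun z => (W z * `|K z| `^ p)%:E).
have I0 : (0 <= I)%E.
  by apply: integral_ge0 => z _; rewrite lee_fin mulr_ge0 ?powR_ge0 ?hardy_weight_ge0.
pose mu : {sigma_finite_measure set T -> \bar R} := point_measure.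
pose F2 (x : T * mR) :=
  (W (tuple_point x.1) * (E x.2 * G (tuple_point x.1) x.2 `^ p))%:E.
have mF2 : measurable_fun setT F2.
  apply/measurable_EFinP; apply: measurable_funM.
    apply: (measurableT_comp (f := W \o @tuple_point R n)); last exact: measurable_fst.
    exact: measurable_hardy_weight.
  apply: measurable_funM; first exact: measurableT_comp mE measurable_snd.
  exact: (measurableT_comp (measurable_powR p) mG).
have F20 x : (0 <= F2 x)%E.
  by rewrite lee_fin !mulr_ge0 ?powR_ge0 ?hardy_weight_ge0.
apply: (@le_trans _ _ (\int[mu]_z \int[leb]_s F2 (z, s))%E).
  rewrite /grushin_integral -ge0_integralZl//; last 3 first.
  - by apply/measurable_EFinP; exact: measurable_weighted.
  - by move=> z _; rewrite lee_fin mulr_ge0 ?powR_ge0 ?hardy_weight_ge0.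
  - by rewrite lee_fin powR_ge0.
  apply: ge0_le_integral => //.
  - by move=> z _; rewrite -EFinM lee_fin !mulr_ge0 ?powR_ge0 ?hardy_weight_ge0.
  - by apply/measurable_EFinP; apply: measurable_funM => //; exact: measurable_weighted.
  - exact: (measurable_fun_fubini_tonelli_F F2).
  - move=> z _; apply: (le_trans _ (pw (tuple_point z))).
    by rewrite -EFinM lee_fin powRM ?(ltW c0)// mulrCA.
have -> : (\int[mu]_z \int[leb]_s F2 (z, s) = \int[leb]_s \int[mu]_z F2 (z, s))%E.
  exact: (@fubini_tonelli _ _ _ _ R mu leb F2 mF2 F20).
rewrite le_eqVlt; apply/orP; left; apply/eqP.
transitivity (\int[leb]_s ((E s)%:E * I))%E.
  apply: eq_integral => s _.
  (* Writing W(z) through W(dil (-s) z) turns the whole integrand at time s into a function of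
     [dil (- s) z]. *)
  pose F z := ((expR (- ((2 * p + beta) * s)) * (E s * expR (- ((n%:R - c) * p * s))))%:E *
               (W z * `|K z| `^ p)%:E)%E.
  transitivity (grushin_integral (fun z => F (dil (- s) z))).
    apply: eq_integral => z _; rewrite /F -EFinM; congr EFin.
    rewrite /G powRM ?expR_ge0// -expRM.
    have -> : W (tuple_point z) =
        expR (- ((2 * p + beta) * s)) * W (dil (- s) (tuple_point z)).
      by rewrite /W -hardy_weight_dil dilD subrr dil0.
    rewrite (_ : - ((n%:R - c) * s) * p = - ((n%:R - c) * p * s)); last by ring.
    move: (expR _) (W _) (E s) (expR _) (_ `^ p) => a w e b k; ring.
  rewrite grushin_integral_dil; last 2 first.
  - apply: measurable_funeM; apply/measurable_EFinP.
    exact: measurable_weighted.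
  - move=> z; rewrite /F -EFinM lee_fin.
    by rewrite !mulr_ge0 ?expR_ge0 ?powR_ge0 ?hardy_weight_ge0.
  rewrite /F /grushin_integral ge0_integralZl//; last 3 first.
  - by apply/measurable_EFinP; exact: measurable_weighted.
  - by move=> z _; rewrite lee_fin mulr_ge0 ?powR_ge0 ?hardy_weight_ge0.
  - by rewrite lee_fin !mulr_ge0 ?expR_ge0.
  rewrite muleA -EFinM; congr (_%:E * _)%E.
  have expR_cancel a b d : a + b + d = 0 ->
      expR a * (expR b * (E s * expR d)) = E s.
    move=> abd; transitivity (E s * expR (a + b + d)); last first.
      by rewrite abd expR0 mulr1.
    by rewrite !expRD; move: (E s) (expR _) (expR _) (expR _) => *; ring.
  (* The exponents Q, -(2p+beta) and -(n-c)p add up to 0, so the slice at time s is [E s] times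
     I. *)
  apply: expR_cancel; rewrite /c /hdim -addn2 natrD; field; lra.
rewrite ge0_integralZr//; last 2 first.
- exact/measurable_EFinP.
- by move=> s _; rewrite lee_fin.
by rewrite integral_exponential_pdf// mul1e.
Qed.

End radial_hardy.

(** * Smooth step functions *)

Section smooth_step.
Context {R : realType}.
Implicit Types (f g w : R^o -> R^o) (x s : R).

Definition smooth f := forall k, Ck k f.

Lemma is_derive_differentiable f (df x : R) :
  is_derive x (1 : R) f df -> differentiable f x.
Proof. by move=> [? _]; apply/derivable1_diffP. Qed.

Lemma Ck_derive1 k f (df : R -> R) : (forall x, is_derive x (1 : R) f (df x)) ->
  Ck k (df : R^o -> R^o) -> Ck k.+1 f.
Proof.
move=> fdf Cdf; have df1 x := is_derive_differentiable (fdf x).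
split=> // v; rewrite (_ : 'D_v f = (cst v \* df)).
  by apply: (@CkM _ _ k (cst v) df) => //; exact: Ck_cst.
apply/funext => x; rewrite deriveE// diff1E//= derive1E.
by have [_ ->] := fdf x.
Qed.

Lemma smooth_is_derive f x : smooth f -> is_derive x (1 : R) f ('D_1 f x).
Proof.
by move=> /(_ 1%N)[df _]; apply: derivableP; exact: diff_derivable.
Qed.

Lemma smooth_derive1 f : smooth f -> smooth ('D_1 f).
Proof. by move=> sf k; have [_] := sf k.+1; apply. Qed.

Lemma smooth_of_derive f (df : R -> R) : (forall x, is_derive x (1 : R) f (df x)) ->
  smooth (df : R^o -> R^o) -> smooth f.
Proof. by move=> fdf sdf k; apply/CkS_Ck/(Ck_derive1 fdf). Qed.

Lemma expR_ge_pow (y : R) k : 0 <= y -> y ^+ k <= k`!%:R * expR y.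
Proof.
move=> y0; case: k => [|k].
  by rewrite expr0 fact0 mul1r -expR0 ler_expR.
rewrite -ler_pdivrMl ?ltr0n ?fact_gt0// mulrC.
by apply: (le_trans _ (expR_ge1Dxn k y0)); rewrite lerDr.
Qed.

Lemma poly_le_expR (P : {poly R}) :
  exists2 C : R, 0 <= C & forall y, 0 <= y -> `|P.[y]| <= C * expR y.
Proof.
exists (\sum_(i < size P) `|P`_i| * i`!%:R).
  by apply: sumr_ge0 => i _; rewrite mulr_ge0.
move=> y y0; rewrite horner_coef (le_trans (ler_norm_sum _ _ _))//.
rewrite mulr_suml ler_sum// => i _; rewrite normrM -mulrA ler_wpM2l//.
by rewrite normrX ger0_norm// expR_ge_pow.
Qed.

(** For P = 1 this is the classical flat function e^(-1/x) extended by 0. The polynomial factor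
    closes the family under differentiation. *)
Definition flat_exp (P : {poly R}) (x : R) : R :=
  if 0 < x then P.[x^-1] * expR (- x^-1) else 0.

Lemma flat_exp_le0 P x : x <= 0 -> flat_exp P x = 0.
Proof. by rewrite leNgt /flat_exp => /negbTE ->. Qed.

(** The exponential dominates the polynomial P X^2 at 1/x. The spare factor x^2 makes the difference
    quotient at 0 tend to 0. *)
Lemma flat_exp_quadratic P :
  exists2 C : R, 0 <= C & forall x, `|flat_exp P x| <= C * x ^+ 2.
Proof.
have [C C0 CP] := poly_le_expR (P * 'X^2); exists C => // x.
rewrite /flat_exp; case: ifPn => x0; last by rewrite normr0 mulr_ge0// sqr_ge0.
have y0 : 0 < x^-1 by rewrite invr_gt0.
rewrite normrM (ger0_norm (expR_ge0 _)) expRN ler_pdivrMr ?expR_gt0//.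
have := CP _ (ltW y0); rewrite hornerM hornerXn normrM (ger0_norm (sqr_ge0 _)).
rewrite exprVn ler_pdivrMr ?exprn_gt0// => H.
by rewrite mulrAC.
Qed.

Lemma is_derive_flat_exp P x :
  is_derive x (1 : R) (flat_exp P : R^o -> R^o) (flat_exp ('X^2 * (P - P^`()%R)) x).
Proof.
have [x0|x0|x0] := ltgtP x 0.
- rewrite [X in is_derive _ _ _ X]flat_exp_le0; last exact: ltW.
  apply: (@near_eq_is_derive _ _ _ (cst 0)).
    by near=> y; rewrite flat_exp_le0// ltW//; near: y; exact: lt_nbhsl.
- have xn0 : x != 0 by rewrite gt_eqF.
  apply: (@near_eq_is_derive _ _ _ (fun x : R => P.[x^-1] * expR (- x^-1))).
    near=> y; rewrite /flat_exp ifT//; near: y; exact: lt_nbhsr.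
  have dV : is_derive x (1 : R) (fun x : R => x^-1 : R) (- x ^- 2).
    apply: is_derive_eq; first exact: (is_deriveV (f := id)).
    by rewrite /GRing.scale/= mulr1.
  have dP := @is_derive1_comp R (horner P) (fun x => x^-1) x _ _ (is_derive_poly _ _) dV.
  have dE : is_derive x (1 : R) (fun x : R => expR (- x^-1) : R) (expR (- x^-1) * x ^- 2).
    apply: is_derive_eq; rewrite /GRing.scale/=; ring.
  refine (is_derive_eq (is_deriveM dP dE) _).
  rewrite /flat_exp x0 !hornerE/= /GRing.scale/=.
  by rewrite exprVn; ring.
- rewrite x0 [X in is_derive _ _ _ X]flat_exp_le0//.
  have [C C0 FC] := flat_exp_quadratic P.
  have L : h^-1 *: ((flat_exp P \o shift 0) (h *: (1 : R)) - flat_exp P 0) @[h --> 0^'] --> (0 : R^o).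
    apply/cvgrPdist_le => e e0; near=> h.
    rewrite sub0r normrN /= addr0 [X in _ - X]flat_exp_le0// subr0.
    rewrite /GRing.scale/= mulr1 normrM normfV.
    have h0 : h != 0 by near: h; exact: nbhs_dnbhs_neq.
    rewrite ler_pdivrMl ?normr_gt0//.
    rewrite (le_trans (FC h))// -(ger0_norm (sqr_ge0 h)) normrX expr2 mulrCA.
    (* C may be 0, so C + 1 is used as the divisor of e. *)
    rewrite ler_wpM2l// (@le_trans _ _ ((C + 1) * `|h|))//.
      by rewrite ler_wpM2r// lerDl.
    rewrite -ler_pdivlMl ?ltr_wpDl// mulrC.
    by near: h; apply: dnbhs0_le; rewrite divr_gt0// ltr_wpDl.
  split; first by apply/cvg_ex; exists 0.
  exact: cvg_lim.
Unshelve. all: by end_near. Qed.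

Lemma smooth_flat_exp P : smooth (flat_exp P : R^o -> R^o).
Proof.
move=> k; elim: k P => [|k IH] P.
  move=> x; apply: differentiable_continuous.
  exact: is_derive_differentiable (is_derive_flat_exp P x).
exact: Ck_derive1 (is_derive_flat_exp P) _.
Qed.

Lemma smooth_affine (a b : R) : smooth (fun s => a * s + b : R^o).
Proof.
apply: (@smooth_of_derive _ (cst a)) => [x|k]; last exact: Ck_cst.
by apply: is_derive_eq; rewrite /GRing.scale/=; ring.
Qed.

Lemma smooth_comp f g : smooth f -> smooth g -> smooth (g \o f).
Proof. by move=> sf sg k; exact: Ck_comp. Qed.

Lemma smoothM f g : smooth f -> smooth g -> smooth (f \* g).
Proof. by move=> sf sg k; exact: CkM. Qed.

Lemma smoothD f g : smooth f -> smooth g -> smooth (f \+ g).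
Proof. by move=> sf sg k; exact: CkD. Qed.

Lemma smooth_cst (a : R) : smooth (cst a).
Proof. by move=> k; exact: Ck_cst. Qed.

Lemma smooth_expRM (a : R) : smooth (fun s => expR (a * s) : R^o).
Proof.
have D (s : R) : is_derive s (1 : R) (fun s => expR (a * s) : R^o) (a * expR (a * s)).
  by apply: is_derive_eq; rewrite /GRing.scale/=; ring.
elim=> [|k IH].
  by move=> s; apply: differentiable_continuous; exact: is_derive_differentiable (D s).
by apply: Ck_derive1 D _; apply: (@CkM _ _ k (cst a)) => //; exact: Ck_cst.
Qed.

(** On [0, 1] the step is e(e(1) - e(1 - s)) / e(e(1)), where e is the flat exponential. For s <= 0,
    monotonicity of e makes the outer argument nonpositive; for s >= 1 the inner term vanishes.
    Nesting needs only compositions and a constant divisor, unlike the usual quotient of flat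
    functions. *)
Lemma exists_smooth_step (a b : R) : a < b ->
  exists2 theta : R^o -> R^o, smooth theta &
    (forall s, s <= a -> theta s = 0) /\ (forall s, b <= s -> theta s = 1).
Proof.
move=> ab; pose e (x : R) := flat_exp 1 x.
have e_gt0 x : 0 < x -> 0 < e x.
  by move=> x0; rewrite /e /flat_exp x0 hornerC mul1r expR_gt0.
have e1 : 0 < e 1 by exact: e_gt0.
pose theta0 : R^o -> R^o := fun s => (e (e 1))^-1 * e (e 1 - e (1 - s)).
have sth0 : smooth theta0.
  have se := smooth_flat_exp 1.
  apply: (@smoothM (cst _) (fun s => e (e 1 - e (1 - s)))); first exact: smooth_cst.
  have s1 := smooth_comp (smooth_comp (smooth_affine (-1) 1) se) (smooth_affine (-1) (e 1)).
  have := smooth_comp s1 se; congr smooth; apply/funext => s /=.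
  by congr (flat_exp 1 _); rewrite mulN1r addrC; congr (_ - flat_exp 1 _); ring.
exists (theta0 \o (fun s => (b - a)^-1 * s + - ((b - a)^-1 * a))).
  by apply: smooth_comp => //; exact: smooth_affine.
have ba : 0 < (b - a)^-1 by rewrite invr_gt0 subr_gt0.
split=> s hs /=; rewrite -mulrBr.
  have {hs} t0 : (b - a)^-1 * (s - a) <= 0 by rewrite pmulr_rle0// subr_le0.
  rewrite /theta0 [X in _ * X]flat_exp_le0 ?mulr0// subr_le0.
  have t1 : 0 < 1 - (b - a)^-1 * (s - a) by lra.
  rewrite /e /flat_exp t1 ltr01 !hornerC !mul1r ler_expR lerN2 lef_pV2 ?posrE//.
  lra.
have t1 : 1 - (b - a)^-1 * (s - a) <= 0.
  by rewrite subr_le0 ler_pdivlMl ?subr_gt0// mulr1 lerD2r.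
by rewrite /theta0 [X in e (_ - X)]flat_exp_le0// subr0 mulVf// gt_eqF// e_gt0.
Qed.

Lemma derive_locally_cst f (a c : R) : smooth f ->
  (forall s, s < a -> f s = c) -> forall s, s < a -> 'D_1 f s = 0.
Proof.
move=> sf fc s sa; rewrite (@near_eq_derive _ _ _ f (cst c)) ?derive_cst//.
by near=> t; rewrite fc//; near: t; exact: lt_nbhsl.
Unshelve. all: by end_near. Qed.

Lemma derive_eq_gt f g (a : R) :
  (forall s, a < s -> f s = g s) -> forall s, a < s -> 'D_1 f s = 'D_1 g s.
Proof.
move=> fg s sa; apply: near_eq_derive.
by near=> t; rewrite fg//; near: t; exact: lt_nbhsr.
Unshelve. all: by end_near. Qed.

(* Since ln vanishes on nonpositive reals, w \o ln is locally constant there. *)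
Lemma is_derive_comp_ln w (a c : R) : 0 < a -> smooth w ->
  (forall s, s < a -> w s = c) -> forall r,
  is_derive r (1 : R) (fun r => w (4^-1 * ln r) : R^o)
    ((fun s => 4^-1 * 'D_1 w s * expR (- (4 * s))) (4^-1 * ln r)).
Proof.
move=> a0 sw wc r; have [r0|r0] := ltP 0 r.
  have dl : is_derive r (1 : R) (fun r => 4^-1 * ln r : R) (4^-1 * r^-1).
    by have dln := is_derive1_ln r0; apply: is_derive_eq; rewrite /GRing.scale/=; ring.
  refine (is_derive_eq (is_derive1_comp (smooth_is_derive _ sw) dl) _).
  (* The factor 1/r is e^(-4s) at s = (ln r)/4, so the derivative is again a function of (ln
     r)/4. *)
  have -> : 4 * (4^-1 * ln r) = ln r by field.
  rewrite expRN lnK ?posrE//; ring.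
have lnr : 4^-1 * ln r = 0 :> R by rewrite ln0// mulr0.
rewrite lnr (derive_locally_cst sw wc)// mulr0 mul0r.
apply: (@near_eq_is_derive _ _ _ (cst c)).
near=> y; have [y0|y0] := ltP 0 y; last by rewrite ln0// mulr0 wc.
rewrite wc// (@le_lt_trans _ _ 0)// pmulr_rle0// ln_le0//.
by rewrite ltW//; near: y; apply: lt_nbhsl; rewrite (le_lt_trans r0).
Unshelve. all: by end_near. Qed.

(** The derivative has the same form with w replaced by w'(s) e^(-4s)/4, which is 0 below a; the
    induction on k therefore runs over all w and c. *)
Lemma smooth_comp_ln w (a c : R) : 0 < a -> smooth w ->
  (forall s, s < a -> w s = c) -> smooth (fun r => w (4^-1 * ln r) : R^o).
Proof.
move=> a0 sw wc k; elim: k w c sw wc => [|k IH] w c sw wc.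
  move=> r; apply: differentiable_continuous.
  exact: is_derive_differentiable (is_derive_comp_ln a0 sw wc r).
apply: Ck_derive1 (is_derive_comp_ln a0 sw wc) _.
apply: (IH (fun s => 4^-1 * 'D_1 w s * expR (- (4 * s))) 0).
  apply: (@smoothM (fun s => 4^-1 * 'D_1 w s) (fun s => expR (- (4 * s)))).
    by apply: (@smoothM (cst _)); [exact: smooth_cst|exact: smooth_derive1].
  have := smooth_expRM (-4); congr smooth.
  by apply/funext => s; rewrite mulNr.
by move=> s sa; rewrite (derive_locally_cst sw wc)// mulr0 mul0r.
Qed.

End smooth_step.

(** * Test functions *)

Section radial_profile.
Context {R : realType}.
Implicit Types (kappa s L : R).

Definition exp_primitive kappa s : R :=
  if kappa == 0 then s else (1 - expR (- kappa * s)) / kappa.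

Lemma is_derive_exp_primitive kappa s :
  is_derive s (1 : R) (exp_primitive kappa : R^o -> R^o) (expR (- kappa * s)).
Proof.
rewrite /exp_primitive; have [->|k0] := eqVneq kappa 0.
  by rewrite oppr0 mul0r expR0; exact: is_derive_id.
rewrite (_ : (fun s : R => _) = (fun s : R => kappa^-1 * (1 - expR (- kappa * s)))).
  by apply: is_derive_eq; rewrite /GRing.scale/=; field.
by apply/funext => t; rewrite mulrC.
Qed.

(** Integrating from 0 to s is integrating to L and then from L to s. Hence subtracting the multiple
    e^(-kappa L) of the translate leaves a constant. *)
Lemma exp_primitive_shift kappa s L :
  exp_primitive kappa s =
  exp_primitive kappa L + expR (- kappa * L) * exp_primitive kappa (s - L).
Proof.
rewrite /exp_primitive; have [->|k0] := eqVneq kappa 0.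
  by rewrite oppr0 mul0r expR0; ring.
have -> : expR (- kappa * s) = expR (- kappa * L) * expR (- kappa * (s - L)).
  by rewrite -expRD; congr expR; ring.
by field.
Qed.

Lemma smooth_exp_primitive kappa : smooth (exp_primitive kappa : R^o -> R^o).
Proof.
by apply: smooth_of_derive (is_derive_exp_primitive kappa) _; exact: smooth_expRM.
Qed.

Lemma derive_expRM kappa s :
  'D_1 (fun s => expR (kappa * s) : R^o) s = kappa * expR (kappa * s).
Proof.
have D : is_derive s (1 : R) (fun s => expR (kappa * s) : R^o) (kappa * expR (kappa * s)).
  by apply: is_derive_eq; rewrite /GRing.scale/=; ring.
by have [_ ->] := D.
Qed.

(** A switched-on profile minus a rescaled delayed copy, which switches it off again near L; m
    adjusts the value at infinity. *)
Definition shift_diff (g : R^o -> R^o) (k L m : R) : R^o -> R^o :=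
  fun s => g s - k * g (s - L) + m.

Lemma smooth_shift_diff g k L m : smooth g -> smooth (shift_diff g k L m).
Proof.
move=> sg; have sL := smooth_comp (smooth_affine 1 (- L)) sg.
have := smoothD (smoothD sg (smoothM (smooth_cst (- k)) sL)) (smooth_cst m).
congr smooth; apply/funext => s; rewrite /shift_diff /= mul1r; ring.
Qed.

Lemma derive_shift_diff g k L m : smooth g ->
  'D_1 (shift_diff g k L m) = shift_diff ('D_1 g) k L 0.
Proof.
move=> sg; apply/funext => s.
have dL : is_derive s (1 : R) (fun s : R => s - L : R) 1.
  by apply: is_derive_eq; rewrite subr0.
have dg := smooth_is_derive s sg.
have dgL : is_derive s (1 : R) (fun s : R => g (s - L)) ('D_1 g (s - L) * 1).
  exact: (@is_derive1_comp R g (fun s => s - L) s _ _ (smooth_is_derive (s - L) sg) dL).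
have : is_derive s (1 : R) (shift_diff g k L m) (shift_diff ('D_1 g) k L 0 s).
  have := is_deriveD (is_deriveB dg (is_deriveZ k dgL)) (is_derive_cst (m : R^o) s 1).
  move=> D; refine (is_derive_eq D _).
  by rewrite /shift_diff /GRing.scale/= mulr1.
by move=> [_ ->].
Qed.

(* With w' = e^{-kappa s} y, the profile has y = 1 on [1, L] and transition
   layers of width one whose size does not depend on L. *)
Lemma exists_plateau_profile kappa (a : R) :
  exists2 B : R, 0 <= B & forall N : nat, (1 <= N)%N ->
  exists w : R^o -> R^o,
  [/\ smooth w,
      exists c, forall s, s < 4^-1 -> w s = c,
      forall s, N.+1%:R <= s -> w s = 0,
      (forall s, s < 0 \/ N.+1%:R <= s -> 'D_1 ('D_1 w) s + a * 'D_1 w s = 0) &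
      [/\ forall s, 1 <= s -> s <= N%:R -> 'D_1 w s = expR (- kappa * s),
       forall s, 1 <= s -> s <= N%:R ->
         'D_1 ('D_1 w) s + a * 'D_1 w s = (a - kappa) * expR (- kappa * s) &
       forall s, `|'D_1 ('D_1 w) s + a * 'D_1 w s| <= B * expR (- kappa * s)]].
Proof.
(* The transition lies strictly inside (0, 1); the positive threshold 1/4 keeps the profile constant
   around s = 0, where [log_rho] puts the origin. *)
have [theta sth [th0 th1]] := @exists_smooth_step R 4^-1 (3 / 4) ltac:(lra).
pose A := exp_primitive kappa.
(* Cutting off the primitive instead of e^(-kappa s) keeps everything explicit, with no integral of
   a cut-off function to evaluate. *)
pose S : R^o -> R^o := A \* theta.
have sS : smooth S by apply: smoothM => //; exact: smooth_exp_primitive.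
have S0 s : s <= 4^-1 -> S s = 0 by move=> h; rewrite /S/= th0// mulr0.
have SA s : 3 / 4 < s -> S s = A s by move=> h; rewrite /S/= th1 ?mulr1// ltW.
have sS1 := smooth_derive1 sS.
have S10 s : s < 4^-1 -> 'D_1 S s = 0.
  by apply: (derive_locally_cst (c := 0)) => // t /ltW; exact: S0.
have S20 s : s < 4^-1 -> 'D_1 ('D_1 S) s = 0.
  exact: (derive_locally_cst (c := 0)).
have S1A s : 3 / 4 < s -> 'D_1 S s = expR (- kappa * s).
  move=> h; rewrite (@derive_eq_gt _ S A (3 / 4))//.
  by have [_ ->] := is_derive_exp_primitive kappa s.
have S2A s : 3 / 4 < s -> 'D_1 ('D_1 S) s = - kappa * expR (- kappa * s).
  move=> h; rewrite -derive_expRM; exact: derive_eq_gt h.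
pose h s : R := 'D_1 ('D_1 S) s + a * 'D_1 S s.
(* Normalised by e^(kappa s), the source is 0 below 1/4 and constant above 3/4, hence bounded by its
   maximum on [0, 1]; the delayed copy only translates g. *)
pose g s : R := expR (kappa * s) * h s.
have gE s : h s = g s * expR (- kappa * s).
  by rewrite /g mulrAC -expRD mulNr subrr expR0 mul1r.
have g0 s : s < 4^-1 -> g s = 0.
  by move=> s0; rewrite /g /h S20// S10// mulr0 addr0 mulr0.
have g1 s : 3 / 4 < s -> g s = a - kappa.
  move=> s0; rewrite /g /h S2A// S1A//.
  have : expR (kappa * s) * expR (- kappa * s) = 1.
    by rewrite -expRD mulNr subrr expR0.
  move: (expR (kappa * s)) (expR (- kappa * s)) => x y xy.
  by transitivity ((a - kappa) * (x * y)); [ring|rewrite xy mulr1].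
have cg : continuous (fun s => `|g s| : R).
  move=> s; apply: continuous_comp; last exact: norm_continuous.
  have cexp : {for s, continuous (fun s : R => expR (kappa * s) : R)}.
    exact: (@smooth_expRM R kappa 0%N s).
  have ch : {for s, continuous (h : R -> R)}.
    have := smoothD (smooth_derive1 sS1) (smoothM (smooth_cst a) sS1).
    by move=> /(_ 0%N) H; exact: (H s).
  exact: (cvgM cexp ch).
have [t _ gt] : exists2 t : R, t \in `[(0 : R), 1] & forall s, s \in `[(0 : R), 1] -> `|g s| <= `|g t|.
  apply: EVT_max => //; exact: continuous_subspaceT.
(* In the first layer only g(s) contributes; in the second, g(s) = a - kappa while g(s - L) is in
   transition. Neither bound involves N. *)
pose B := `|g t| + `|a - kappa|.
have gB s : `|g s| <= `|g t|.
  have [s0|s0] := ltP s 0; first by rewrite g0 ?normr0//; lra.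
  have [s1|s1] := leP s 1; first by apply: gt; rewrite in_itv/= s0.
  have -> : g s = g 1 by rewrite !g1//; lra.
  by apply: gt; rewrite in_itv/= ler01 lexx.
exists B => [|N N1]; first by rewrite addr_ge0.
pose L : R := N%:R; pose k := expR (- kappa * L).
have L1 : 1 <= L by rewrite ler1n.
(* Past L + 3/4 the two copies differ by A L, which the added constant removes; below 1/4 the
   profile equals - A L. *)
exists (shift_diff S k L (- A L)).
have DwE : 'D_1 (shift_diff S k L (- A L)) = shift_diff ('D_1 S) k L 0.
  exact: derive_shift_diff.
have D2wE : 'D_1 ('D_1 (shift_diff S k L (- A L))) = shift_diff ('D_1 ('D_1 S)) k L 0.
  by rewrite DwE derive_shift_diff.
have D1 s : 'D_1 (shift_diff S k L (- A L)) s = shift_diff ('D_1 S) k L 0 s.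
  exact: (congr1 (fun f => f s) DwE).
have D2 s : 'D_1 ('D_1 (shift_diff S k L (- A L))) s =
    shift_diff ('D_1 ('D_1 S)) k L 0 s.
  exact: (congr1 (fun f => f s) D2wE).
have hE s : 'D_1 ('D_1 (shift_diff S k L (- A L))) s +
    a * 'D_1 (shift_diff S k L (- A L)) s = (g s - g (s - L)) * expR (- kappa * s).
  rewrite D2 D1 /shift_diff !addr0.
  have -> : expR (- kappa * s) = k * expR (- kappa * (s - L)).
    by rewrite /k -expRD; congr expR; ring.
  transitivity (h s - k * h (s - L)); first by rewrite /h; ring.
  rewrite !gE.
  have -> : expR (- kappa * s) = k * expR (- kappa * (s - L)).
    by rewrite /k -expRD; congr expR; ring.
  by ring.
split.
- exact: smooth_shift_diff.
- exists (- A L) => s s0; rewrite /shift_diff !S0; [by ring|lra|lra].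
- move=> s; rewrite -natr1 -/L => sL; rewrite /shift_diff !SA; [|lra|lra].
  by rewrite /A (exp_primitive_shift kappa s L) -/k; ring.
- move=> s; rewrite -natr1 -/L hE => -[s0|s0].
    by rewrite !g0 ?subrr ?mul0r//; lra.
  by rewrite !g1 ?subrr ?mul0r//; lra.
- split.
  + move=> s s1; rewrite -/L => sL; rewrite D1 /shift_diff S1A; last by lra.
    by rewrite S10 ?mulr0 ?subr0 ?addr0//; lra.
  + move=> s s1; rewrite -/L => sL; rewrite hE g1; last by lra.
    by rewrite g0 ?subr0//; lra.
  + move=> s; rewrite hE normrM (ger0_norm (expR_ge0 _)) ler_wpM2r ?expR_ge0//.
    have [sL|sL] := ltP (s - L) 0.
      rewrite [g (s - L)]g0; last by lra.
      by rewrite subr0 (le_trans (gB _))// lerDl.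
    rewrite [g s]g1; last by lra.
    by rewrite (le_trans (ler_normB _ _))// addrC lerD2r.
Qed.

End radial_profile.

(** * Functions of ln rho on the Grushin space *)

Section radial_functions.
Context {R : realType} {n : nat}.
Local Notation V := ('rV[R]_n * R)%type.
Implicit Types (w : R^o -> R^o) (z : V).

(* Equal to [ln (rho z)], also at the origin since [ln 0 = 0]. *)
Definition log_rho (z : V) : R := 4^-1 * ln (rho4 z).

Lemma rho4_eq0 z : (rho4 z == 0) = (z == 0).
Proof.
apply/idP/eqP => [|->]; last first.
  by rewrite /rho4 /sqnorm big1 ?expr0n/= ?mulr0 ?addr0// => i _; rewrite mxE expr0n.
have t20 : 0 <= 4 * z.2 ^+ 2 by rewrite mulr_ge0 ?sqr_ge0.
rewrite /rho4 (paddr_eq0 (sqr_ge0 _) t20) sqrf_eq0 {t20} => /andP[].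
rewrite mulf_eq0 sqrf_eq0 pnatr_eq0/= /sqnorm psumr_eq0 => [|i _]; last exact: sqr_ge0.
move=> /allP x0 /eqP t0; rewrite [z]surjective_pairing t0; congr pair.
apply/rowP => i; rewrite mxE; apply/eqP; rewrite -sqrf_eq0.
by have := x0 i; rewrite mem_index_enum => /(_ isT).
Qed.

Lemma rho_log_rho z : 0 < rho4 z -> rho z = expR (log_rho z).
Proof. by move=> z0; rewrite rhoE /log_rho mulrC expRM lnK. Qed.

Lemma log_rho_dil s z : 0 < rho4 z -> log_rho (dil s z) = s + log_rho z.
Proof.
move=> z0; rewrite /log_rho rho4_dil lnM ?posrE ?expR_gt0// expRK.
by rewrite mulrDr mulrA mulVf// mul1r.
Qed.

Lemma rho4_log_rho T z : 0 <= T -> log_rho z < T -> rho4 z < expR (4 * T).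
Proof.
move=> T0 zT; have [z0|z0] := leP (rho4 z) 0.
  by rewrite (le_lt_trans z0)// expR_gt0.
by rewrite -[X in X < _]lnK ?posrE// ltr_expR -ltr_pdivrMl.
Qed.

Lemma log_rho_bounded T z : 0 <= T -> log_rho z < T ->
  (forall i, `|z.1 ord0 i| <= expR (2 * T)) /\ `|z.2| <= expR (2 * T).
Proof.
move=> T0 /(rho4_log_rho T0) zT; have e1 : 1 <= expR (2 * T).
  by rewrite -expR0 ler_expR mulr_ge0.
have e4 : expR (4 * T) = expR (2 * T) ^+ 2.
  by rewrite -expRM_natl; congr expR; ring.
have S0 := sqnorm_ge0 z; have t20 := sqr_ge0 z.2.
have sqr_le (x y : R) : 0 <= y -> x ^+ 2 <= y ^+ 2 -> `|x| <= y.
  move=> y0; rewrite -(real_normK (num_real x)) ler_pXn2r//.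
split=> [i|].
  have xS : z.1 ord0 i ^+ 2 <= sqnorm z.
    rewrite /sqnorm (bigD1 i)//= lerDl; apply: sumr_ge0 => j _; exact: sqr_ge0.
  have Se : sqnorm z <= expR (2 * T).
    rewrite -(ger0_norm S0); apply: sqr_le; first exact: expR_ge0.
    by rewrite -e4; move: zT; rewrite /rho4; lra.
  apply: sqr_le; first exact: expR_ge0.
  (* Since e^(2T) >= 1, it is at most its square, so one bound serves for x and t. *)
  by rewrite (le_trans xS)// (le_trans Se)// ler_eXnr.
apply: sqr_le; first exact: expR_ge0.
by rewrite -e4; move: zT; rewrite /rho4; have := sqr_ge0 (sqnorm z); lra.
Qed.

Section radial.
Variables (w : R^o -> R^o) (a c : R).
Hypotheses (a0 : 0 < a) (sw : smooth w) (wc : forall s, s < a -> w s = c).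

Lemma Ck_radial k : Ck k (w \o log_rho : V -> R^o).
Proof.
exact: (@Ck_comp _ _ k rho4 _ (@Ck_rho4 R n k) (smooth_comp_ln a0 sw wc k)).
Qed.

(** Off the origin [log_rho] increases at unit speed along the flow. At the origin both sides are 0,
    since w is constant around 0. *)
Lemma euler_radial : euler (w \o log_rho : V -> R) = 'D_1 w \o log_rho.
Proof.
apply/funext => z; have [z0|z0] := eqVneq (rho4 z) 0.
  move/eqP : (z0); rewrite rho4_eq0 => /eqP ->; rewrite euler0 /=.
  rewrite (derive_locally_cst sw wc)// /log_rho.
  have /eqP -> : rho4 (0 : V) == 0 by rewrite rho4_eq0.
  by rewrite ln0// mulr0.
have {}z0 : 0 < rho4 z by rewrite lt0r z0 rho4_ge0.
have du : differentiable (w \o log_rho : V -> R^o) z.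
  by have [+ _] := Ck_radial 1; apply.
have := @is_derive_dil R n (w \o log_rho) 0 z; rewrite dil0 => /(_ du) [_ <-].
have -> : (fun s => (w \o log_rho) (dil s z)) = (fun s => w (s + log_rho z)).
  by apply/funext => s; rewrite /= log_rho_dil.
have dL : is_derive (0 : R) (1 : R) (fun s : R => s + log_rho z : R) 1.
  by apply: is_derive_eq; rewrite addr0.
have := smooth_is_derive (0 + log_rho z) sw.
move=> dw; have := @is_derive1_comp R w (fun s => s + log_rho z) 0 _ _ dw dL.
by move=> [_ ->]; rewrite add0r mulr1.
Qed.

Lemma Cc_infty_radial T : 0 <= T -> (forall s, T <= s -> w s = 0) ->
  Cc_infty (w \o log_rho : V -> R).
Proof.
move=> T0 wT; split; first exact: Ck_radial.
pose M := expR (2 * T).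
pose K : set V := [set x : 'rV[R]_n | forall i, `[- M, M]%classic (x ord0 i)] `*` `[- M, M]%classic.
have cK : compact K.
  apply: compact_setX; last exact: segment_compact.
  apply: (rV_compact (A := fun=> `[- M, M]%classic)) => i; exact: segment_compact.
apply: (subclosed_compact _ cK); first exact: closed_closure.
have clK : closed K.
  by apply: compact_closed => //; exact: norm_hausdorff.
rewrite [X in _ `<=` X](iffLR (closure_id K) clK); apply: closure_subset => z /= uz.
have zT : log_rho z < T by rewrite ltNge; apply: contra uz => /wT ->.
have [x1 t1] := log_rho_bounded T0 zT.
by split => /= [i|]; rewrite in_itv/= -ler_norml.
Qed.

End radial.
End radial_functions.

(** * Sharpness *)

Section shells.
Context {R : realType} {n : nat}.
Local Notation V := ('rV[R]_n * R)%type.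
Local Notation mR := (measurableTypeR R).
Local Notation T := (n.-tuple mR * mR)%type.
Local Notation leb := (@lebesgue_measure R).
Variables (p beta : R).
Hypotheses (n1 : (1 <= n)%N) (p1 : 1 < p).
Let c : R := (hdim R n * (p - 1) + beta) / p.
Let kappa : R := n%:R - c.
Let p0 : 0 < p. Proof. exact: lt_trans ltr01 p1. Qed.

Definition box (a b a' b' : R) : set T :=
  [set x : n.-tuple mR | forall i, `[a, b]%classic (tnth x i)] `*` `[a', b']%classic.

Lemma measurable_tuple_box (a b : R) :
  measurable [set x : n.-tuple mR | forall i, `[a, b]%classic (tnth x i)].
Proof.
rewrite (_ : mkset _ = \bigcap_(i in [set: 'I_n])
     ((fun x : n.-tuple mR => tnth x i) @^-1` `[a, b]%classic)).
  apply: fin_bigcap_measurable => // i _; rewrite -[X in measurable X]setTI.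
  by apply: measurable_tnth => //; exact: measurable_itv.
by apply/seteqP; split=> x /= xA => [i _|i]; exact: xA.
Qed.

Lemma measurable_box a b a' b' : measurable (box a b a' b').
Proof.
by apply: measurableX; [exact: measurable_tuple_box|exact: measurable_itv].
Qed.

Lemma point_measure_box a b a' b' : a < b -> a' < b' ->
  point_measure (box a b a' b') = ((b - a) ^+ n * (b' - a'))%:E.
Proof.
move=> ab ab'; rewrite /point_measure product_measure1E//; last first.
  exact: measurable_tuple_box.
transitivity ((\prod_(i < n) leb `[a, b]%classic) * leb `[a', b']%classic)%E.
  congr (_ * _)%E; apply: (prodleb_box (A := fun=> `[a, b]%classic)) => i.
  exact: measurable_itv.
under eq_bigr do rewrite lebesgue_measure_itv/= lte_fin ab -EFinB.
rewrite prodEFin prodr_const card_ord lebesgue_measure_itv/= lte_fin ab'.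
by rewrite -EFinB -EFinM.
Qed.

Definition shell_density (z : V) : R :=
  hardy_weight p beta z * expR (- (kappa * p) * log_rho z).

Definition shell (a b : R) (z : V) : R :=
  shell_density z * ((a <= log_rho z) && (log_rho z < b))%:R.

Lemma shell_density_ge0 z : 0 <= shell_density z.
Proof. by rewrite mulr_ge0 ?hardy_weight_ge0 ?expR_ge0. Qed.

Lemma shell_ge0 a b z : 0 <= shell a b z.
Proof. by rewrite mulr_ge0 ?shell_density_ge0. Qed.

Lemma measurable_shell a b : measurable_fun setT (shell a b \o @tuple_point R n : T -> R).
Proof.
have ml : measurable_fun setT (log_rho \o @tuple_point R n : T -> R).
  apply: measurable_funM; first exact: measurable_cst.
  apply: (measurableT_comp (f := @ln R)); first exact: measurable_ln.
  by apply: measurable_tuple_point; exact: (@Ck_rho4 R n 0).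
apply: measurable_funM; first apply: measurable_funM.
- exact: measurable_hardy_weight.
- apply: (measurableT_comp (f := fun s : R => expR (- (kappa * p) * s))) => //.
  apply: continuous_measurable_fun; exact: (@smooth_expRM R _ 0%N).
- apply: (measurableT_comp (f := fun s : R => ((a <= s) && (s < b))%:R : R)) => //.
  rewrite (_ : (fun s : R => _) = \1_(`[a, b[%classic : set R)).
    exact: measurable_indic.
  by apply/funext => s; rewrite indicE mem_setE in_itv.
Qed.

Lemma measurable_eshell a b :
  measurable_fun setT (fun z : T => (shell a b (tuple_point z))%:E).
Proof. by have /measurable_EFinP := measurable_shell a b. Qed.

(** The origin has the default [log_rho] 0 and would spoil the equivariance of the shells under
    dilation; its density is 0, so it is harmless. *)
Lemma rho4_eq0_shell_density z : rho4 z = 0 -> shell_density z = 0.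
Proof.
move=> /eqP; rewrite -rho_eq0 => /eqP /rho_eq0_psi psi0.
by rewrite /shell_density /hardy_weight psi0 sqrtr0 powR0 ?mul0r// gt_eqF.
Qed.

Lemma kappa_p : kappa * p = hdim R n - 2 * p - beta.
Proof. by rewrite /kappa /c /hdim -addn2 natrD; field; rewrite gt_eqF. Qed.

Lemma shell_densityE z : 0 < rho4 z ->
  shell_density z = Num.sqrt (psi z) `^ p * expR (- (hdim R n * log_rho z)).
Proof.
move=> z0; rewrite /shell_density /hardy_weight rho_log_rho// -expRM -mulrA -expRD.
by congr (_ * expR _); rewrite kappa_p; ring.
Qed.

Lemma shell_dil a b z : shell (a + 1) (b + 1) (dil 1 z) = expR (- hdim R n) * shell a b z.
Proof.
have [z0|z0] := eqVneq (rho4 z) 0.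
  by rewrite /shell !rho4_eq0_shell_density ?mul0r ?mulr0// rho4_dil z0 mulr0.
have {}z0 : 0 < rho4 z by rewrite lt0r z0 rho4_ge0.
have z1 : 0 < rho4 (dil 1 z) by rewrite rho4_dil mulr_gt0 ?expR_gt0.
rewrite /shell !shell_densityE// log_rho_dil// psi_dil !(addrC _ 1) lerD2l ltrD2l.
have -> : expR (- (hdim R n * (1 + log_rho z))) =
    expR (- hdim R n) * expR (- (hdim R n * log_rho z)).
  by rewrite -expRD; congr expR; ring.
by rewrite [X in X * _]mulrCA -!mulrA.
Qed.

Definition shell_mass (a b : R) : \bar R := grushin_integral (fun z => (shell a b z)%:E).

Lemma shell_mass_shift a b : shell_mass (a + 1) (b + 1) = shell_mass a b.
Proof.
have ms a' b' : measurable_fun setT ((fun z => (shell a' b' z)%:E) \o @tuple_point R n : T -> \bar R).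
  by have /measurable_EFinP := measurable_shell a' b'.
have := @grushin_integral_dil R n 1 (fun z => (shell (a + 1) (b + 1) z)%:E) (ms _ _).
rewrite mulr1 => H.
(* The factor e^(-Q) from the density matches the Jacobian. It is removed by multiplying with e^Q,
   which is legitimate also for an infinite mass. *)
transitivity ((expR (hdim R n))%:E * ((expR (- hdim R n))%:E * shell_mass (a + 1) (b + 1)))%E.
  by rewrite muleA -EFinM -expRD subrr expR0 mul1e.
rewrite /shell_mass -H => [|z]; last by rewrite lee_fin shell_ge0.
transitivity ((expR (hdim R n))%:E * ((expR (- hdim R n))%:E * shell_mass a b))%E;
  last by rewrite muleA -EFinM -expRD subrr expR0 mul1e.
congr (_ * _)%E; rewrite /shell_mass /grushin_integral -ge0_integralZl//.
- by apply: eq_integral => z _; rewrite shell_dil EFinM.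
- exact: ms.
- by move=> z _; rewrite lee_fin shell_ge0.
Qed.

Lemma shell_mass_nat (j : nat) : shell_mass j%:R j.+1%:R = shell_mass 0 1.
Proof.
by elim: j => [//|j IH]; rewrite -IH -(shell_mass_shift j%:R) !natr1.
Qed.

Lemma shell_mass_plateau (N : nat) : (1 <= N)%N ->
  shell_mass 1 N%:R = ((N.-1)%:R%:E * shell_mass 0 1)%E.
Proof.
case: N => // N _; elim: N => [|N IH]/=.
  rewrite mul0e /shell_mass /grushin_integral; apply: integral0_eq => z _.
  by rewrite /shell; case: ltP; rewrite ?andbF ?mulr0// leNgt => /negbTE ->; rewrite mulr0.
transitivity (shell_mass 1 N.+1%:R + shell_mass N.+1%:R N.+2%:R)%E.
  rewrite /shell_mass /grushin_integral -ge0_integralD//.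
  - apply: eq_integral => z _; rewrite -EFinD -mulrDr; congr (_ * _)%:E.
    set s := log_rho _; have N1 : 1 <= N.+1%:R :> R by rewrite ler1n.
    have N2 : N.+1%:R < N.+2%:R :> R by rewrite ltr_nat.
    have [sN|sN] := ltP s N.+1%:R.
      by rewrite (lt_trans sN N2) !andbT addr0.
    by rewrite (le_trans N1 sN) andbF add0r.
  - by move=> z _; rewrite lee_fin shell_ge0.
  - exact: measurable_eshell.
  - by move=> z _; rewrite lee_fin shell_ge0.
  - exact: measurable_eshell.
rewrite IH shell_mass_nat -[X in (_ + X)%E]mul1e -ge0_muleDl ?lee_fin//.
by rewrite -EFinD natr1.
Qed.

Lemma psi_le1 (z : V) : psi z <= 1.
Proof.
have [z0|z0] := eqVneq (rho z) 0; first by rewrite (rho_eq0_psi z0).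
have {}z0 : 0 < rho z by rewrite lt0r z0 rho_ge0.
rewrite psiE ler_pdivrMr ?exprn_gt0// mul1r -(ler_pXn2r (n := 2))//.
- by rewrite -exprM rho_exp4 /rho4 lerDl mulr_ge0 ?sqr_ge0.
- by rewrite nnegrE sqnorm_ge0.
- by rewrite nnegrE sqr_ge0.
Qed.

(** For 0 <= ln rho < 1 the density psi^(p/2) rho^(-Q) is at most 1, and the shell lies in the box
    of half-side e^2. *)
Lemma shell_mass_lty : (shell_mass 0 1 < +oo)%E.
Proof.
pose r : R := expR (2 * 1).
have r0 : 0 < r by exact: expR_gt0.
apply: (@le_lt_trans _ _ (\int[point_measure]_z (\1_(box (- r) r (- r) r) z)%:E)%E).
  apply: ge0_le_integral => //.
  - by move=> z _; rewrite lee_fin shell_ge0.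
  - exact: measurable_eshell.
  - by apply/measurable_EFinP; apply: measurable_indic; exact: measurable_box.
  - move=> z _; rewrite lee_fin indicE; case: (boolP (z \in _)) => [_|zB].
      have [z0|z0] := eqVneq (rho4 (tuple_point z)) 0.
        by rewrite /shell rho4_eq0_shell_density ?mul0r.
      have {}z0 : 0 < rho4 (tuple_point z) by rewrite lt0r z0 rho4_ge0.
      rewrite /shell; have [/andP[s0 s1]|_] := boolP (_ && _); last by rewrite mulr0.
      rewrite mulr1 shell_densityE//.
      rewrite mulr_ile1 ?powR_ge0 ?expR_ge0//.
        have := @ge0_ler_powR R p (ltW p0) (Num.sqrt (psi (tuple_point z))) 1.
        rewrite !nnegrE sqrtr_ge0 ler01 powR1; apply => //.
        by rewrite -sqrtr1 ler_wsqrtr// psi_le1.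
      by rewrite expR_le1 oppr_le0 mulr_ge0.
    rewrite /shell; have [/andP[s0 s1]|_] := boolP (_ && _); last by rewrite mulr0.
    have [x1 t1] := log_rho_bounded ler01 s1.
    move: zB; rewrite notin_setE => -[]; split => /= [i|].
      by have := x1 i; rewrite mxE ler_norml in_itv.
    by rewrite in_itv/= -ler_norml.
rewrite integral_indic ?setIT//; last exact: measurable_box.
by rewrite [X in (X < _)%E]point_measure_box ?ltry//; lra.
Qed.

(** The box 1/(2n) <= x_i <= 1/n, 1/2 <= t <= 1 lies in the shell: |x|^2 <= 1 gives 1 <= rho^4 <= 5
    < e^4. It stays away from the axis x = 0, where [psi] vanishes. *)
Lemma shell_mass_gt0 : (0 < shell_mass 0 1)%E.
Proof.
pose q : R := n%:R^-1.
have n0 : 0 < n%:R :> R by rewrite ltr0n.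
have q0 : 0 < q by rewrite invr_gt0.
(* On the box |x|^2 >= 1/(4n), and rho < e bounds both the denominator of [psi] and rho^(-Q). *)
pose d : R := Num.sqrt ((4 * n%:R)^-1 / expR 1 ^+ 2) `^ p * expR (- hdim R n).
have d0 : 0 < d.
  by rewrite mulr_gt0 ?expR_gt0// powR_gt0// sqrtr_gt0 divr_gt0 ?exprn_gt0 ?expR_gt0// invr_gt0 mulr_gt0.
apply: (@lt_le_trans _ _ (\int[point_measure]_z (d%:E * (\1_(box (q / 2) q 2^-1 1) z)%:E))%E).
  rewrite ge0_integralZl//; last 2 first.
  - by apply/measurable_EFinP; apply: measurable_indic; exact: measurable_box.
  - by rewrite lee_fin ltW.
  rewrite integral_indic ?setIT//; last exact: measurable_box.
  rewrite [X in (_ * X)%E]point_measure_box; [|lra|lra].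
  by rewrite -EFinM lte_fin mulr_gt0// mulr_gt0 ?exprn_gt0//; lra.
apply: ge0_le_integral => //.
- by move=> z _; rewrite -EFinM lee_fin mulr_ge0// ltW.
- apply/measurable_EFinP; apply: measurable_funM => //.
  by apply: measurable_indic; exact: measurable_box.
- exact: measurable_eshell.
move=> z _; rewrite -EFinM lee_fin indicE; case: (boolP (z \in _)) => [zB|_]; last first.
  by rewrite mulr0 shell_ge0.
rewrite mulr1; move: zB; rewrite inE => -[/= xB]; rewrite in_itv/= => /andP[t1 t2].
set y := tuple_point z.
have x2 i : (q / 2) ^+ 2 <= y.1 ord0 i ^+ 2 <= q ^+ 2.
  have := xB i; rewrite /y /= mxE in_itv/= => /andP[h1 h2].
  by rewrite !ler_pXn2r ?nnegrE ?h1 ?h2//; lra.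
have S1 : (4 * n%:R)^-1 <= sqnorm y.
  rewrite (@le_trans _ _ (\sum_(i < n) (q / 2) ^+ 2))//.
    by rewrite sumr_const card_ord -mulr_natl /q le_eqVlt; apply/orP; left; apply/eqP; field; lra.
  by apply: ler_sum => i _; have /andP[] := x2 i.
have S2 : sqnorm y <= 1.
  rewrite (@le_trans _ _ (\sum_(i < n) q ^+ 2))//.
    by apply: ler_sum => i _; have /andP[] := x2 i.
  rewrite sumr_const card_ord -mulr_natl expr2 mulrA mulfV ?gt_eqF// mul1r.
  by rewrite invf_le1// ler1n.
have S0 : 0 < (4 * n%:R)^-1 :> R by rewrite invr_gt0 mulr_gt0.
have yt : y.2 = z.2 by [].
have tt : 2^-1 ^+ 2 <= z.2 ^+ 2 <= 1 ^+ 2.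
  by rewrite !ler_pXn2r ?nnegrE ?t1 ?t2//; lra.
have r1 : 1 <= rho4 y.
  rewrite /rho4 yt; have := sqr_ge0 (sqnorm y); move/andP : tt => [+ _].
  by rewrite !expr2; lra.
have r5 : rho4 y <= 1 + 4.
  rewrite /rho4 yt lerD//; last by move/andP : tt => [_]; lra.
  by rewrite expr_le1// sqnorm_ge0.
have r0 : 0 < rho4 y by lra.
have s0 : 0 <= log_rho y by rewrite mulr_ge0// ln_ge0.
have s1 : log_rho y < 1.
  rewrite /log_rho ltr_pdivrMl// mulr1 -ltr_expR lnK ?posrE//.
  by rewrite (le_lt_trans r5)// expR_gt1Dx.
rewrite /shell s0 s1 mulr1 shell_densityE// /d ler_pM ?powR_ge0 ?expR_ge0//; last first.
  by rewrite ler_expR lerN2 ger_pMr ?ltW// /hdim ltr0n.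
rewrite ge0_ler_powR ?nnegrE ?sqrtr_ge0 ?(ltW p0)// ler_wsqrtr// psiE.
rewrite ler_pM ?invr_ge0 ?sqr_ge0// ?mulr_ge0// lef_pV2 ?posrE ?exprn_gt0 ?expR_gt0 ?rho_gt0//.
rewrite ler_pXn2r ?nnegrE ?expR_ge0 ?rho_ge0// rho_log_rho// ler_expR ltW//.
Qed.

End shells.

Arguments shell_mass {R} n p beta a b.

(** * Plateau functions and the quotient of the two integrals *)

Section sharpness.
Context {R : realType} {n : nat}.
Local Notation V := ('rV[R]_n * R)%type.
Local Notation mR := (measurableTypeR R).
Local Notation T := (n.-tuple mR * mR)%type.
Variables (p beta : R).
Hypotheses (n1 : (1 <= n)%N) (p1 : 1 < p).
Let c : R := (hdim R n * (p - 1) + beta) / p.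
Hypothesis c0 : 0 < c.
Let p0 : 0 < p. Proof. exact: lt_trans ltr01 p1. Qed.

Definition weighted_integral (g : V -> R) : \bar R :=
  grushin_integral (fun z => (hardy_weight p beta z * `|g z| `^ p)%:E).

(** On the plateau 1 <= ln rho < N the gradient integrand is the shell density and the source
    integrand is c^p times it. The source is at most B^p times the density on the two layers and 0
    elsewhere; on the gradient side the layers are simply dropped. *)
Lemma plateau_function :
  exists2 B : R, 0 <= B & forall N : nat, (1 <= N)%N ->
  exists u : V -> R^o,
  [/\ Cc_infty u,
      (shell_mass n p beta 1 N%:R <= weighted_integral (euler u))%E &
      (weighted_integral (hardy_source u) <=
        (c `^ p)%:E * shell_mass n p beta 1 N%:R +
        ((B `^ p)%:E * shell_mass n p beta 0 1 +
         (B `^ p)%:E * shell_mass n p beta N%:R N.+1%:R))%E].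
Proof.
pose kappa : R := n%:R - c.
have [B B0 HB] := exists_plateau_profile kappa n%:R.
exists B => // N N1; have [w [sw [m wm] w0 wout [w1 w2 wB]]] := HB N N1.
have q0 : 0 < 4^-1 :> R by [].
exists (w \o log_rho).
have E1 : euler (w \o log_rho : V -> R) = 'D_1 w \o log_rho.
  exact: (euler_radial q0 sw wm).
have E2 : euler ('D_1 w \o log_rho : V -> R) = 'D_1 ('D_1 w) \o log_rho.
  apply: (euler_radial q0 (smooth_derive1 sw)) => s; exact: (derive_locally_cst sw wm).
have powE (x s : R) : 0 <= x -> (x * expR (- kappa * s)) `^ p = x `^ p * expR (- (kappa * p) * s).
  move=> x0; rewrite powRM ?expR_ge0// -expRM; congr (_ * expR _); ring.
have N0 : 1 <= N%:R :> R by rewrite ler1n.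
have NS : N.+1%:R = N%:R + 1 :> R by rewrite natr1.
have Cu : Ck 2 (w \o log_rho : V -> R^o) by exact: (Ck_radial q0 sw wm).
split.
- exact: (Cc_infty_radial q0 sw wm _ w0).
- apply: ge0_le_integral => //.
  + by move=> z _; rewrite lee_fin shell_ge0.
  + exact: measurable_eshell.
  + apply/measurable_EFinP; apply: measurable_weighted.
    exact: (@Ck_euler _ _ 0 _ (CkS_Ck Cu)).
  move=> z _; rewrite lee_fin -/(tuple_point z); set y := tuple_point z.
  rewrite E1 /shell /=; have [/andP[s1 s2]|_] := boolP (_ && _); last first.
    by rewrite mulr0 mulr_ge0 ?hardy_weight_ge0 ?powR_ge0.
  rewrite mulr1 w1 ?(ltW s2)// ger0_norm ?expR_ge0// -[X in X `^ p]mul1r powE//.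
  by rewrite powR1 mul1r.
- have KE : hardy_source (w \o log_rho : V -> R) =
      (fun s => 'D_1 ('D_1 w) s + n%:R * 'D_1 w s) \o log_rho.
    by rewrite /hardy_source E1 E2.
  pose F a b z : \bar R := (shell p beta a b (@tuple_point R n z))%:E.
  have mF (k a b : R) : measurable_fun setT (fun z : T => k%:E * F a b z)%E.
    by apply: measurable_funeM; exact: measurable_eshell.
  have F0 (k a b : R) z : 0 <= k -> (0 <= k%:E * F a b z)%E.
    by move=> k0; rewrite -EFinM lee_fin mulr_ge0 ?shell_ge0.
  have FE (k a b : R) : 0 <= k ->
      (k%:E * shell_mass n p beta a b = \int[point_measure]_z (k%:E * F a b z))%E.
    move=> k0; rewrite ge0_integralZl//; first exact: measurable_eshell.
    by move=> z _; rewrite lee_fin shell_ge0.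
  have cp0 := powR_ge0 c p; have Bp0 := powR_ge0 B p.
  rewrite !FE// -ge0_integralD//; try by move=> z _; exact: F0.
  rewrite -ge0_integralD//; last 3 first.
  + by move=> z _; exact: F0.
  + by move=> z _; rewrite adde_ge0 ?F0.
  + exact: emeasurable_funD.
  apply: ge0_le_integral => //.
  + by move=> z _; rewrite lee_fin mulr_ge0 ?hardy_weight_ge0 ?powR_ge0.
  + by apply/measurable_EFinP; apply: measurable_weighted; exact: continuous_hardy_source.
  + by apply: emeasurable_funD => //; exact: emeasurable_funD.
  move=> z _; rewrite -!EFinM -!EFinD lee_fin -/(tuple_point z); set y := tuple_point z.
  rewrite KE /=; set s := log_rho y.
  have d0 := shell_density_ge0 p beta y.
  have bound (k : R) : 0 <= k -> `|'D_1 ('D_1 w) s + n%:R * 'D_1 w s| <= k * expR (- kappa * s) ->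
      hardy_weight p beta y * `|'D_1 ('D_1 w) s + n%:R * 'D_1 w s| `^ p <=
      k `^ p * shell_density p beta y.
    move=> k0 Dk; rewrite /shell_density mulrCA ler_wpM2l ?hardy_weight_ge0// -/s.
    rewrite -powE// ge0_ler_powR ?(ltW p0)// nnegrE// mulr_ge0// expR_ge0.
  have [s0|s0] := ltP s 0.
    rewrite wout; last by left.
    rewrite normr0 powR0 ?gt_eqF// mulr0.
    by do 2?[apply: addr_ge0]; apply: mulr_ge0 => //; exact: shell_ge0.
  have [sN|sN] := leP N.+1%:R s.
    rewrite wout; last by right.
    rewrite normr0 powR0 ?gt_eqF// mulr0.
    by do 2?[apply: addr_ge0]; apply: mulr_ge0 => //; exact: shell_ge0.
  rewrite /shell -/s s0 sN /= andbT.
  have [s1|s1] := ltP s 1.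
    rewrite /= !mulr0 add0r mulr1 (le_trans (bound B B0 (wB s)))// lerDl.
    by apply: mulr_ge0 => //; exact: mulr_ge0.
  have [s2|s2] := ltP s N%:R; rewrite /= !mulr0.
    rewrite mulr1 !addr0; apply: bound; first exact: ltW.
    rewrite w2 ?(ltW s2)// normrM (ger0_norm (expR_ge0 _)).
    (* The profile was built with a = n, so its plateau coefficient a - kappa is c. *)
    by rewrite (_ : n%:R - kappa = c) ?(ger0_norm (ltW c0))// /kappa; ring.
  by rewrite !add0r mulr1 bound.
Qed.

(** With m the mass of a unit shell, the source integral is at most ((N-1) c^p + 2 B^p) m and the
    gradient integral at least (N-1) m. As m is positive and finite, it cancels. *)
Lemma radial_hardy_sharp (C' : R) : c `^ p < C' ->
  exists2 u : V -> R^o, Cc_infty u &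
    (weighted_integral (hardy_source u) < C'%:E * weighted_integral (euler u))%E.
Proof.
move=> cC'; have [B B0 HB] := plateau_function.
have M0 := @shell_mass_gt0 R n p beta n1 p1.
have [m mE] : exists m, shell_mass n p beta 0 1 = m%:E.
  exists (fine (shell_mass n p beta 0 1)); rewrite fineK// ge0_fin_numE ?(ltW M0)//.
  exact: shell_mass_lty.
have m0 : 0 < m by move: M0; rewrite mE lte_fin.
(* Then N - 1 exceeds 2 B^p / (C' - c^p), so the gain on the plateau outweighs both layers. *)
pose N := (Num.truncn (2 * B `^ p / (C' - c `^ p))).+2.
have [u [Cu uge ule]] := HB N isT; exists u => //.
have plateauE := @shell_mass_plateau R n p beta p1 N isT.
have C'0 : 0 < C' by rewrite (le_lt_trans _ cC')// powR_ge0.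
apply: (le_lt_trans ule); apply: (@lt_le_trans _ _ (C'%:E * shell_mass n p beta 1 N%:R)%E).
  rewrite plateauE shell_mass_nat// mE -!EFinM -!EFinD lte_fin !mulrA -!mulrDl ltr_pM2r//.
  rewrite -ltrBrDl -mulrBl -mulr2n -(mulr_natl (B `^ p)) -ltr_pdivrMl ?subr_gt0// mulrC.
  exact: truncnS_gt.
by apply: lee_wpmul2l => //; rewrite lee_fin ltW.
Qed.

End sharpness.

(** * The inequality and the optimality of its constant *)

Unset Implicit Arguments.
Local Close Scope classical_set_scope.

Theorem theorem4p2 (R : realType) (n : nat) (p beta : R) :
  (1 <= n)%N ->
  1 < p -> p < hdim R n ->
  - (hdim R n * (p - 1)) < beta -> beta < hdim R n - p ->
  let C : R := ((hdim R n * (p - 1) + beta) / p) `^ p in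
  let lap_integral (u : 'rV[R]_n * R -> R) : \bar R :=
    grushin_integral (fun z =>
      (`|radial_lap u z| `^ p /
       (enorm (grushin_grad (@rho R n) z) `^ p * rho z `^ beta))%:E) in
  let grad_integral (u : 'rV[R]_n * R -> R) : \bar R :=
    grushin_integral (fun z =>
      (enorm (radial_grad u z) `^ p / rho z `^ (p + beta))%:E) in
  (forall u : 'rV[R]_n * R -> R, Cc_infty u ->
    (C%:E * grad_integral u <= lap_integral u)%E) /\
  (forall C' : R, C < C' ->
    ~ (forall u : 'rV[R]_n * R -> R, Cc_infty u ->
        (C'%:E * grad_integral u <= lap_integral u)%E)).

Proof.
move=> n1 p1 _ betaQ _ C lap_integral grad_integral.
have p0 : 0 < p := lt_trans ltr01 p1.
(* The lower bound on beta says exactly that the exponential density has a positive rate. *)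
have c0 : 0 < (hdim R n * (p - 1) + beta) / p.
  by rewrite divr_gt0// addrC -(opprK (hdim R n * (p - 1))) subr_gt0.
have lapE u : Cc_infty u -> lap_integral u = weighted_integral p beta (hardy_source u).
  move=> [Cu _]; rewrite /lap_integral /weighted_integral; congr grushin_integral.
  by apply/funext => z; rewrite lap_integrandE// gt_eqF.
have gradE u : grad_integral u = weighted_integral p beta (euler u).
  rewrite /grad_integral /weighted_integral; congr grushin_integral.
  by apply/funext => z; rewrite grad_integrandE// gt_eqF.
split=> [u Cu|C' CC' HC'].
  by rewrite lapE// gradE; apply: radial_hardy => //; exact: (proj1 Cu).
have [u Cu] := radial_hardy_sharp n1 p1 c0 CC'.
by rewrite ltNge -lapE// -gradE HC'.
Qed.
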